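(* For every MCFT-transducer $G$ over $\Sigma$ and every $\Delta\subseteq\Sigma$, there is a polynomial time algorithm that, on input $w\in\Delta^*$, outputs a regular tree grammar $H_w$ and an MCFT-transducer $G_w$ such that \[L(H_w)=\{d\in L(G_{\mathrm{der}})\mid\mathrm{val}(d)\in\tau(G_w)\}\quad\text{and}\quad\tau(G_w)=\{(t_1,t_2)\in\tau(G)\mid\mathrm{yd}_\Delta(t_1)=w\}.\] The degree of the polynomial (in the length of $w$; $G$ and $\Delta$ are fixed) is $\mu(G)\cdot(\theta(G)+1)\cdot(\lambda(G)+1)$.
   Context: **Sequences and trees.** $\mathbb N_0$ is the set of nonnegative integers, $[n]=\{1,\dots,n\}$. $A^*$ (resp. $A^+$) is the set of finite (resp. nonempty finite) sequences over $A$; a sequence of length 1 is identified with its element; juxtaposition is concatenation; $\mathrm{occ}(w)$ is the set of elements occurring in the sequence $w$; $w$ is repetition-free if no element occurs twice in it. A ranked alphabet is a set $\Sigma$ with a rank map $\mathrm{rk}\colon\Sigma\to\mathbb N_0$ (applied elementwise to sequences); $\Sigma^{(k)}$ is the set of symbols of rank $k$. $T_\Sigma$ is the set of trees over $\Sigma$: the smallest set of strings over $\Sigma$ containing $\sigma t_1\cdots t_k$ (also written $\sigma(t_1,\dots,t_k)$) for all $\sigma\in\Sigma^{(k)}$ and $t_i\in T_\Sigma$. A forest is a finite sequence of trees. $X=\{x_1,x_2,\dots\}$ is a set of variables (of rank 0, disjoint from other alphabets), $X_k=\{x_1,\dots,x_k\}$. A pattern of rank $k$ over $\Sigma$ is a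 tree over $\Sigma\cup X_k$ in which each of $x_1,\dots,x_k$ occurs exactly once; $P_\Sigma(X_k)$ is the set of these and $P_\Sigma(X)=\bigcup_k P_\Sigma(X_k)$. For a forest $t$, $\mathrm{occ}_\Omega(t)$ is the set of symbols of $\Omega$ occurring in $t$; $t$ is uniquely $\Omega$-labeled if each symbol of $\Omega$ occurs at most once in $t$. For $\Delta\subseteq\Sigma$, $\mathrm{yd}_\Delta(t)$ is the string obtained from the string $t$ by erasing all symbols not in $\Delta$. A regular tree grammar over $\Omega$ is a context-free grammar generating a subset of $T_\Omega$ whose nonterminals have rank 0 and whose rules have the form $A\to\omega(A_1,\dots,A_k)$ with nonterminals $A,A_1,\dots,A_k$ and $\omega\in\Omega^{(k)}$. **Substitution.** For a repetition-free sequence of symbols $\sigma=(\sigma_1,\dots,\sigma_n)$ and patterns $u=(u_1,\dots,u_n)$ with $\mathrm{rk}(u)=\mathrm{rk}(\sigma)$, $t[\sigma\gets u]$ is obtained from $t$ by replacing, recursively, each subtree $\sigma_i(s_1,\dots,s_k)$ by $u_i$ in which $x_j$ is replaced by the transformed $s_j$ (componentwise on forests). For $\mathcal L=\{B_1,\dots,B_k\}$ with $B_1\cdots B_k$ repetition-free and forests $f(B_i)$ with $\mathrm{rk}(f(B_i))=\mathrm{rk}(B_i)$, $t[B\gets f(B)\mid B\in\mathcal L]$ means $t[B_1\cdots B_k\gets f(B_1)\cdots f(B_k)]$. **MCFT-transducer.** An MCFT-transducer over $\Sigma$ is $G=(N,\mathcal N,\Sigma,S,R)$ where $N$ is a finite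 ranked alphabet of nonterminals; $\mathcal N\subseteq N^+$ is a finite set of repetition-free sequences (big nonterminals) with $\mathrm{occ}(A)\ne\mathrm{occ}(A')$ for distinct $A,A'\in\mathcal N$; $\Sigma$ is a finite ranked alphabet disjoint from $N$ containing a symbol of rank at least 1; $R$ is a finite set of rules $A\to(u,\mathcal L)$ with $A\in\mathcal N$, $u\in P_{N\cup\Sigma}(X)^+$ a uniquely $N$-labeled forest with $\mathrm{rk}(u)=\mathrm{rk}(A)$, and $\mathcal L\subseteq\mathcal N$ (the links) such that the sets $\mathrm{occ}(B)$, $B\in\mathcal L$, are pairwise disjoint with union $\mathrm{occ}_N(u)$; $S=(S_1,S_2)\in\mathcal N$ with $S_1,S_2\in N^{(0)}$ is the initial big nonterminal, and $S_1,S_2$ do not occur in right-hand sides of rules. Moreover $N$ is partitioned into $N_1$ and $N_2$ such that $S_1\in N_1$, $S_2\in N_2$, and for every rule $(A_1,\dots,A_n)\to((u_1,\dots,u_n),\mathcal L)$, $j\in[n]$ and $i\in\{1,2\}$: if $A_j\in N_i$ then $\mathrm{occ}_N(u_j)\subseteq N_i$. The sets $L(G,A)$, $A\in\mathcal N$, are simultaneously the smallest sets of forests such that for every rule $A\to(u,\mathcal L)$ and all $f(B)\in L(G,B)$ ($B\in\mathcal L$), $u[B\gets f(B)\mid B\in\mathcal L]\in L(G,A)$. $G$ realizes $\tau(G)=L(G,S)\subseteq T_\Sigma\times T_\Sigma$. The multiplicity is $\mu(G)=\max\{|A|:A\in\mathcal N\}$, the width is $\theta(G)=\max\{\mathrm{rk}(C):C\in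 N\}$, and the rule-width $\lambda(G)$ is the maximal number $|\mathcal L|$ of links of a rule. **Derivation trees.** For every rule fix a linear order on its links; a rule with $k$ links has rank $k$, so $R$ is a ranked alphabet. The sets $L(G_{\mathrm{der}},A)\subseteq T_R$ are the smallest sets such that $\rho(d_1,\dots,d_k)\in L(G_{\mathrm{der}},A)$ whenever $\rho=A\to(u,\{B_1,\dots,B_k\})\in R$ (links in their order) and $d_i\in L(G_{\mathrm{der}},B_i)$; and $\mathrm{val}(\rho(d_1,\dots,d_k))=u[B_i\gets\mathrm{val}(d_i)\mid 1\le i\le k]$. $L(G_{\mathrm{der}})=L(G_{\mathrm{der}},(S_1,S_2))$. *)

(* Defs.v *)
From HB Require Import structures.
From mathcomp Require Import all_boot ssralg poly.

Set Implicit Arguments.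
Unset Strict Implicit.
Unset Printing Implicit Defensive.

(* Finite sets of names, big nonterminals, rules and links are represented    *)
(* by sequences: only membership matters, so repetitions are harmless (the    *)
(* links of a rule are kept duplicate-free, see below).                       *)

Inductive tree (A : Type) : Type := Node of A & seq (tree A).

Section TreeEq.
Variable A : Type.

Fixpoint gen_of_tree (t : tree A) : GenTree.tree A :=
  let: Node a ts := t in
  GenTree.Node 0 (GenTree.Leaf a :: map gen_of_tree ts).

Fixpoint tree_of_gen (g : GenTree.tree A) : option (tree A) :=
  if g is GenTree.Node _ (GenTree.Leaf a :: gs)
  then Some (Node a (pmap tree_of_gen gs)) else None.

Lemma gen_of_treeK : pcancel gen_of_tree tree_of_gen.
Proof.
rewrite /pcancel; fix IH 1 => -[a ts] /=; congr (Some (Node a _)).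
by elim: ts => //= t ts IHts; rewrite IH /= IHts.
Qed.

End TreeEq.

HB.instance Definition _ (A : eqType) :=
  Equality.copy (tree A) (pcan_type (@gen_of_treeK A)).

(* The string (prefix) notation of a tree. *)
Fixpoint preorder A (t : tree A) : seq A :=
  let: Node a ts := t in a :: flatten (map (@preorder A) ts).

Fixpoint tree_map A B (f : A -> B) (t : tree A) : tree B :=
  let: Node a ts := t in Node (f a) (map (tree_map f) ts).

Fixpoint ranked A (rk : A -> nat) (t : tree A) : bool :=
  let: Node a ts := t in (size ts == rk a) && all (ranked rk) ts.

Definition yd (Sigma : finType) (Delta : {set Sigma}) (t : tree Sigma) :
  seq Sigma := [seq a <- preorder t | a \in Delta].

(* V is a universe of nonterminal names.  The constructors keep nonterminals, *)
(* terminals and variables disjoint; Vr i is the variable x_(i+1).            *)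
Inductive sym (V T : Type) := Nt of V | Tm of T | Vr of nat.
Arguments Nt {V T}.
Arguments Tm {V T}.
Arguments Vr {V T}.

Section SymEq.
Variables V T : Type.
Definition sum_of_sym (s : sym V T) : V + T + nat :=
  match s with Nt v => inl (inl v) | Tm a => inl (inr a) | Vr i => inr i end.
Definition sym_of_sum (s : V + T + nat) : sym V T :=
  match s with inl (inl v) => Nt v | inl (inr a) => Tm a | inr i => Vr i end.
Lemma sum_of_symK : cancel sum_of_sym sym_of_sum.
Proof. by case. Qed.
End SymEq.

HB.instance Definition _ (V T : eqType) :=
  Equality.copy (sym V T) (can_type (@sum_of_symK V T)).

Definition sym_rk V T (rkN : V -> nat) (rk : T -> nat) (s : sym V T) : nat :=
  match s with Nt v => rkN v | Tm a => rk a | Vr _ => 0 end.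

(* Occurrences, in prefix order and with repetitions. *)
Definition vars V T (t : tree (sym V T)) : seq nat :=
  pmap (fun s : sym V T => if s is Vr i then Some i else None) (preorder t).
Definition occN V T (t : tree (sym V T)) : seq V :=
  pmap (fun s : sym V T => if s is Nt v then Some v else None) (preorder t).
Definition occN_forest V T (u : seq (tree (sym V T))) : seq V :=
  flatten (map (@occN V T) u).

Definition pattern V T (rkN : V -> nat) (rk : T -> nat) (k : nat)
    (t : tree (sym V T)) : bool :=
  ranked (sym_rk rkN rk) t && perm_eq (vars t) (iota 0 k).

Fixpoint plug V T (ts : seq (tree (sym V T))) (t : tree (sym V T)) :=
  let: Node a us := t in
  if a is Vr i then nth t ts i else Node a (map (plug ts) us).

(* t[s <- u] *)
Fixpoint subst (V : eqType) T (s : seq V) (u : seq (tree (sym V T)))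
    (t : tree (sym V T)) : tree (sym V T) :=
  let: Node a ts := t in
  let t' := Node a (map (subst s u) ts) in
  if a is Nt v then
    if v \in s then plug (map (subst s u) ts) (nth t' u (index v s)) else t'
  else t'.

(* u[B <- f B | B in links] *)
Definition subst_links (V : eqType) T (links : seq (seq V))
    (f : seq V -> seq (tree (sym V T))) (u : seq (tree (sym V T))) :=
  map (subst (flatten links) (flatten (map f links))) u.

(* A rule A -> (u, L) is the triple (A, u, L); the order of the sequence L is *)
(* the fixed linear order on the links.                                       *)
Definition rule (V T : Type) : Type :=
  (seq V * seq (tree (sym V T)) * seq (seq V))%type.

HB.instance Definition _ (V T : eqType) := Equality.on (rule V T).

Section RuleProj.
Variables V T : Type.
Definition lhs (r : rule V T) : seq V := r.1.1.
Definition rhs (r : rule V T) : seq (tree (sym V T)) := r.1.2.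
Definition links (r : rule V T) : seq (seq V) := r.2.
End RuleProj.

Record transducer (V T : Type) := Transducer {
  nts   : seq V;
  nt_rk : V -> nat;          (* relevant on nts only *)
  bigs  : seq (seq V);
  S1    : V;
  S2    : V;
  rules : seq (rule V T)
}.

Section Transducers.
Variables (V T : eqType) (rk : T -> nat).
Implicit Types (G : transducer V T) (r : rule V T).

Record wf_rule G r : Prop := WfRule {
  wf_lhs   : lhs r \in bigs G;
  wf_size  : size (rhs r) = size (lhs r);
  wf_pat   : forall C t, (C, t) \in zip (lhs r) (rhs r) ->
               pattern (nt_rk G) rk (nt_rk G C) t;
  wf_uniqN : uniq (occN_forest (rhs r));
  wf_links_uniq : uniq (links r);
  wf_links_bigs : {subset links r <= bigs G};
  wf_links_disj : {in links r &, forall B B' : seq V,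
                     B != B' -> ~~ has (mem B) B'};
  wf_links_occ  : flatten (links r) =i occN_forest (rhs r);
  wf_S1 : S1 G \notin occN_forest (rhs r);
  wf_S2 : S2 G \notin occN_forest (rhs r)
}.

Record wf G : Prop := Wf {
  wf_sigma : exists a : T, 0 < rk a;
  wf_bigs  : forall A, A \in bigs G ->
               [/\ A != [::], uniq A & {subset A <= nts G}];
  wf_occ   : {in bigs G &, forall A A' : seq V, A =i A' -> A = A'};
  wf_S     : [:: S1 G; S2 G] \in bigs G;
  wf_S_rk  : nt_rk G (S1 G) = 0 /\ nt_rk G (S2 G) = 0;
  wf_rules : forall r, r \in rules G -> wf_rule G r;
  (* The links of a rule form a set, so two rules never differ in the order   *)
  (* of their links only.                                                     *)
  wf_order : {in rules G &, forall r r', lhs r = lhs r' -> rhs r = rhs r' ->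
               links r =i links r' -> r = r'};
  (* N1 and N2 are the parts of nts G on which inN1 is true, resp. false.     *)
  wf_part  : exists inN1 : pred V,
    [/\ inN1 (S1 G), ~~ inN1 (S2 G)
      & forall r, r \in rules G ->
        forall C t, (C, t) \in zip (lhs r) (rhs r) ->
        {in occN t, forall D, inN1 D = inN1 C}]
}.

Inductive Lang G : seq V -> seq (tree (sym V T)) -> Prop :=
| Lang_rule r (f : seq V -> seq (tree (sym V T))) :
    r \in rules G ->
    (forall B, B \in links r -> Lang G B (f B)) ->
    Lang G (lhs r) (subst_links (links r) f (rhs r)).

Definition emb (t : tree T) : tree (sym V T) := tree_map Tm t.

Definition tau G (t1 t2 : tree T) : Prop :=
  Lang G [:: S1 G; S2 G] [:: emb t1; emb t2].

Definition mult G : nat := \max_(A <- bigs G) size A.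
Definition width G : nat := \max_(C <- nts G) nt_rk G C.
Definition rule_width G : nat := \max_(r <- rules G) size (links r).

Definition rule_rk r : nat := size (links r).

Inductive Lder_at G : seq V -> tree (rule V T) -> Prop :=
| Lder_rule r (ds : seq (tree (rule V T))) :
    r \in rules G -> size ds = rule_rk r ->
    (forall B d, (B, d) \in zip (links r) ds -> Lder_at G B d) ->
    Lder_at G (lhs r) (Node r ds).

Definition Lder G (d : tree (rule V T)) : Prop :=
  Lder_at G [:: S1 G; S2 G] d.

Fixpoint der_val (d : tree (rule V T)) : seq (tree (sym V T)) :=
  let: Node r ds := d in
  map (subst (flatten (links r)) (flatten (map der_val ds))) (rhs r).

End Transducers.

Record rtg (W Omega : Type) := Rtg {
  rtg_nts   : seq W;
  rtg_init  : W;
  rtg_rules : seq (W * Omega * seq W)     (* A -> omega(A_1, ..., A_k) *)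
}.

Record wf_rtg (W Omega : eqType) (alphabet : seq Omega) (rk : Omega -> nat)
    (H : rtg W Omega) : Prop := WfRtg {
  wf_rtg_init  : rtg_init H \in rtg_nts H;
  wf_rtg_rules : forall A a As, (A, a, As) \in rtg_rules H ->
    [/\ A \in rtg_nts H, a \in alphabet, size As = rk a
      & {subset As <= rtg_nts H}]
}.

Inductive rtg_gen (W Omega : eqType) (H : rtg W Omega) :
    W -> tree Omega -> Prop :=
| Rtg_rule A a As ts :
    (A, a, As) \in rtg_rules H -> size ts = size As ->
    (forall B t, (B, t) \in zip As ts -> rtg_gen H B t) ->
    rtg_gen H A (Node a ts).

Definition rtg_lang (W Omega : eqType) (H : rtg W Omega) (t : tree Omega) :
  Prop := rtg_gen H (rtg_init H) t.

(* Random access machines with uniform cost: every instruction and every test *)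
(* takes one step.  The memory is an array of natural numbers, with direct    *)
(* addressing by constants and indirect addressing.  The input is a read-only *)
(* array, the output is write-only.  Addition and truncated subtraction are   *)
(* the only arithmetic operations (without multiplication, uniform cost is    *)
(* polynomially related to Turing machine time), and control is structured.   *)
Inductive cmd :=
| CSkip
| CSet (r c : nat)
| CAdd (r a b : nat)
| CSub (r a b : nat)
| CLoad (r a : nat)
| CStore (a r : nat)
| CLen (r : nat)
| CRead (r a : nat)
| CWrite (r : nat)
| CSeq (c1 c2 : cmd)
| CIf (r : nat) (c1 c2 : cmd)
| CWhile (r : nat) (c : cmd).

Record state := State { mem_of : nat -> nat; out_of : seq nat }.

Definition upd (s : state) (r x : nat) : state :=
  State (fun a => if a == r then x else mem_of s a) (out_of s).

(* exec inp c s s' t: started in s, the command c halts in s' after t steps.  *)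
Inductive exec (inp : seq nat) : cmd -> state -> state -> nat -> Prop :=
| ExSkip s : exec inp CSkip s s 1
| ExSet r c s : exec inp (CSet r c) s (upd s r c) 1
| ExAdd r a b s :
    exec inp (CAdd r a b) s (upd s r (mem_of s a + mem_of s b)) 1
| ExSub r a b s :
    exec inp (CSub r a b) s (upd s r (mem_of s a - mem_of s b)) 1
| ExLoad r a s :
    exec inp (CLoad r a) s (upd s r (mem_of s (mem_of s a))) 1
| ExStore a r s :
    exec inp (CStore a r) s (upd s (mem_of s a) (mem_of s r)) 1
| ExLen r s : exec inp (CLen r) s (upd s r (size inp)) 1
| ExRead r a s :
    exec inp (CRead r a) s (upd s r (nth 0 inp (mem_of s a))) 1
| ExWrite r s :
    exec inp (CWrite r) s (State (mem_of s) (rcons (out_of s) (mem_of s r))) 1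
| ExSeq c1 c2 s s' s'' t1 t2 :
    exec inp c1 s s' t1 -> exec inp c2 s' s'' t2 ->
    exec inp (CSeq c1 c2) s s'' (t1 + t2)
| ExIfT r c1 c2 s s' t :
    mem_of s r != 0 -> exec inp c1 s s' t -> exec inp (CIf r c1 c2) s s' t.+1
| ExIfF r c1 c2 s s' t :
    mem_of s r = 0 -> exec inp c2 s s' t -> exec inp (CIf r c1 c2) s s' t.+1
| ExWhileT r c s s' s'' t1 t2 :
    mem_of s r != 0 -> exec inp c s s' t1 ->
    exec inp (CWhile r c) s' s'' t2 ->
    exec inp (CWhile r c) s s'' (t1 + t2).+1
| ExWhileF r c s :
    mem_of s r = 0 -> exec inp (CWhile r c) s s 1.

Definition computes (P : cmd) (inp out : seq nat) (t : nat) : Prop :=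
  exists s, exec inp P (State (fun=> 0) [::]) s t /\ out_of s = out.

(* Output grammars have sequences of natural numbers as nonterminals.  All    *)
(* codes below are prefix codes: a sequence is written item by item, each     *)
(* item preceded by 1, with a final 0.                                        *)

Definition enc_seq A (e : A -> seq nat) (s : seq A) : seq nat :=
  flatten [seq 1 :: e x | x <- s] ++ [:: 0].

Definition enc_letter (T : finType) (a : T) : nat := enum_rank a.

Definition enc_word (T : finType) (w : seq T) : seq nat := map (@enc_letter T) w.

Definition enc_name (v : seq nat) : seq nat := enc_seq (fun k => [:: k]) v.

Section Encodings.
Variable T : finType.

Definition enc_sym (s : sym (seq nat) T) : seq nat :=
  match s with
  | Nt v => 0 :: enc_name v
  | Tm a => [:: 1; enc_letter a]
  | Vr i => [:: 2; i]
  end.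

Fixpoint enc_tree (t : tree (sym (seq nat) T)) : seq nat :=
  let: Node a ts := t in enc_sym a ++ enc_seq enc_tree ts.

Definition enc_rule (r : rule (seq nat) T) : seq nat :=
  enc_seq enc_name (lhs r) ++ enc_seq enc_tree (rhs r)
  ++ enc_seq (enc_seq enc_name) (links r).

Definition enc_transducer (G : transducer (seq nat) T) : seq nat :=
  enc_seq (fun C => rcons (enc_name C) (nt_rk G C)) (nts G)
  ++ enc_seq (enc_seq enc_name) (bigs G)
  ++ enc_name (S1 G) ++ enc_name (S2 G)
  ++ enc_seq enc_rule (rules G).

End Encodings.

(* A symbol of the alphabet is written as its position in that alphabet. *)
Definition enc_rtg (Omega : eqType) (alphabet : seq Omega)
    (H : rtg (seq nat) Omega) : seq nat :=
  enc_seq enc_name (rtg_nts H)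
  ++ enc_name (rtg_init H)
  ++ enc_seq (fun p : seq nat * Omega * seq (seq nat) =>
        enc_name p.1.1 ++ index p.1.2 alphabet :: enc_seq enc_name p.2)
      (rtg_rules H).

(* Main.v *)
Require Import Defs.
From mathcomp Require Import all_boot ssralg poly zify.

(* The grammars are a Bar-Hillel construction.  A nonterminal C of rank k is  *)
(* annotated with k + 1 pairs of positions of w: those at which a pattern     *)
(* generated by C is entered and left, and, for every variable, those between *)
(* which the tree substituted for the variable is read.  A rule is kept with  *)
(* an annotation of its nonterminals if the traversal of its right-hand side  *)
(* is consistent with it; components in N2 read no letter at all.             *)
(* Traversing a right-hand side, all positions are determined by one position *)
(* per pair: the start and the positions after the variables for the left-    *)
(* hand side, the end and the positions before the variables for the          *)
(* nonterminals of the right-hand side.  A rule involves at most              *)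
(* mult G * (rule_width G + 1) nonterminals with at most width G + 1 pairs    *)
(* each, which bounds the number of nested loops over 0..|w| enumerating the  *)
(* annotated rules.  Every position is a loop variable plus a constant, so    *)
(* that each annotated rule is written in constant time.                      *)

Set Implicit Arguments.
Unset Strict Implicit.
Unset Printing Implicit Defensive.

(** * Trees, patterns and full substitution *)

(** Why the annotated grammars are correct. A pattern contains each of its variables exactly once,
    so one pair of positions per variable records how it reads the input; a right-hand side contains
    each nonterminal at most once, so annotations found in different places of it never conflict.
    [run] says that the traversal of a tree respects given annotations.

    Two converse facts about substitution carry the proof. If a right-hand side runs consistently
    and every nonterminal is replaced by a pattern that reads as annotated, then so does the result
    ([run_bsub]). Conversely, a run of the result yields bounded annotations under which the
    right-hand side and all substituted patterns run ([run_unbsub]). By induction, the first fact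
    shows that erasing annotations maps the forests of the new transducer to forests of [G] that
    read as prescribed ([Lang_Gw]), and the second that the tree grammar generates every derivation
    of [G] whose value reads as prescribed ([Lder_rtg_gen]). [rtg_gen_Gw] links the tree grammar to
    the new transducer. On a ground tree, a run from 0 to |w| means that the yield is w ([run_emb],
    [reads_start]). This gives [tau_GwP] and [rtg_lang_HwP].

    Why the program has the stated degree. The right-hand sides do not depend on w, so they are
    traversed symbolically, once and for all ([walk_tree], [walk_rule]): in terms of the free
    positions, every other position is an explicit expression, and validity is a finite list of
    letter comparisons. [slots_bound] bounds the number of free positions. The annotated rules are
    thus listed by nested loops over 0..|w| whose innermost body takes constant time; [emits]
    composes such programs together with their time bounds, up to [emits_output]. *)

Fixpoint allProp A (P : A -> Prop) (s : seq A) : Prop :=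
  if s is x :: s' then P x /\ allProp P s' else True.

(** The generated principle has no hypothesis for subtrees, as these are nested in a sequence. *)
Lemma tree_ind_all A (P : tree A -> Prop) :
  (forall a ts, allProp P ts -> P (Node a ts)) -> forall t, P t.
Proof.
move=> H; fix IH 1; case=> a ts; apply: H.
by elim: ts => //= t ts IHts; split.
Qed.

Lemma allProp_map_eq A B (f g : A -> B) s :
  allProp (fun x => f x = g x) s -> map f s = map g s.
Proof. by elim: s => //= x s IH [-> /IH ->]. Qed.

Lemma pmap_flatten A B (f : A -> option B) ss :
  pmap f (flatten ss) = flatten (map (pmap f) ss).
Proof. by elim: ss => //= s ss IH; rewrite pmap_cat IH. Qed.

Lemma pmap_pcomp A A' B B' (f : A -> option B) (f' : A' -> option B') h k s :
  (forall x, f' (h x) = omap k (f x)) -> pmap f' (map h s) = map k (pmap f s).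
Proof. by move=> E; elim: s => //= x s IH; rewrite E; case: (f x) => /= [y|];
  rewrite IH. Qed.

Section Occurrences.
Variables V T : Type.
Implicit Types (c : sym V T) (t : tree (sym V T)) (ts : seq (tree (sym V T))).

Lemma occN_node c ts :
  occN (Node c ts) = (if c is Nt v then [:: v] else [::]) ++ occN_forest ts.
Proof.
by rewrite /occN /= pmap_flatten -map_comp; case: c.
Qed.

Lemma vars_node c ts :
  vars (Node c ts) =
    (if c is Vr i then [:: i] else [::]) ++ flatten (map (@vars V T) ts).
Proof.
by rewrite /vars /= pmap_flatten -map_comp; case: c.
Qed.

Lemma occN_forest_cons t ts : occN_forest (t :: ts) = occN t ++ occN_forest ts.
Proof. by []. Qed.

End Occurrences.

(** * Renaming of nonterminals *)

Definition rn V W T (g : V -> W) (s : sym V T) : sym W T :=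
  match s with Nt v => Nt (g v) | Tm a => Tm a | Vr i => Vr i end.

Section Renaming.
Variables V W T : Type.
Implicit Types (g : V -> W) (t : tree (sym V T)).

Lemma preorder_map A B (f : A -> B) (t : tree A) :
  preorder (tree_map f t) = map f (preorder t).
Proof.
elim/tree_ind_all: t => a ts IH /=; congr (_ :: _).
rewrite map_flatten -!map_comp; congr flatten.
exact: allProp_map_eq.
Qed.

Lemma occN_rn g t : occN (tree_map (rn g) t) = map g (occN t).
Proof. by rewrite /occN preorder_map; apply: pmap_pcomp; case. Qed.

Lemma occN_forest_rn g ts :
  occN_forest (map (tree_map (rn (T := T) g)) ts) = map g (occN_forest ts).
Proof.
by rewrite /occN_forest map_flatten -!map_comp; congr flatten; apply: eq_map => t /=;
  apply: occN_rn.
Qed.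

Lemma vars_rn g t : vars (tree_map (rn g) t) = vars t.
Proof.
rewrite /vars preorder_map -[RHS]map_id.
by apply: (@pmap_pcomp _ _ _ _ _ _ (rn g)); case.
Qed.

End Renaming.

Lemma eq_in_rn (V : eqType) W T (g g' : V -> W) (t : tree (sym V T)) :
  {in occN t, g =1 g'} -> tree_map (rn g) t = tree_map (rn g') t.
Proof.
elim/tree_ind_all: t => c ts IH H /=; congr Node.
  by case: c H => //= v H; congr Nt; apply: H; rewrite occN_node mem_head.
have {}H: {in occN_forest ts, g =1 g'}.
  by move=> v hv; apply: H; rewrite occN_node mem_cat hv orbT.
elim: ts IH H => //= t ts IHts [IHt IH] H; congr (_ :: _).
  by apply: IHt => v hv; apply: H; rewrite occN_forest_cons mem_cat hv.
by apply: IHts => // v hv; apply: H; rewrite occN_forest_cons mem_cat hv orbT.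
Qed.

Lemma tree_map_id_in (V : eqType) T (g : V -> V) (t : tree (sym V T)) :
  {in occN t, g =1 id} -> tree_map (rn g) t = t.
Proof.
move=> H; rewrite (@eq_in_rn _ _ _ _ id) //.
elim/tree_ind_all: t {H} => c ts IH /=; congr Node; first by case: c.
by rewrite -[RHS]map_id; apply: allProp_map_eq.
Qed.

Lemma tree_map_comp A B C (f : B -> C) (g : A -> B) t :
  tree_map f (tree_map g t) = tree_map (f \o g) t.
Proof.
elim/tree_ind_all: t => c ts IH /=; congr Node.
by rewrite -map_comp; apply: allProp_map_eq.
Qed.

Lemma tree_map_ext A B (f g : A -> B) : f =1 g -> tree_map f =1 tree_map g.
Proof.
move=> E t; elim/tree_ind_all: t => c ts IH /=; rewrite E; congr Node.
exact: allProp_map_eq.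
Qed.

Section FullSubstitution.
Variables (V : eqType) (T : Type).
Implicit Types (t : tree (sym V T)) (U : V -> tree (sym V T)).

(* [subst] when every nonterminal of the tree is replaced. *)
Fixpoint bsub U t : tree (sym V T) :=
  let: Node c ts := t in
  if c is Nt v then plug (map (bsub U) ts) (U v) else Node c (map (bsub U) ts).

(** Turns the list-based substitution into one by a function; the default [d] is never reached,
    since every occurring nonterminal has an index in [s]. *)
Lemma subst_bsub d (s : seq V) u t : size u = size s -> {subset occN t <= s} ->
  subst s u t = bsub (fun v => nth d u (index v s)) t.
Proof.
move=> Hsz; elim/tree_ind_all: t => c ts IH H /=.
have {}IH: map (subst s u) ts = map (bsub (fun v => nth d u (index v s))) ts.
  have {}H: {subset occN_forest ts <= s}.
    by move=> v hv; apply: H; rewrite occN_node mem_cat hv orbT.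
  elim: ts IH H => //= t ts IHts [IHt IH] H; congr (_ :: _).
    by apply: IHt => v hv; apply: H; rewrite occN_forest_cons mem_cat hv.
  by apply: IHts => // v hv; apply: H; rewrite occN_forest_cons mem_cat hv orbT.
case: c H => [v|a|i] H; rewrite IH //.
have hv: v \in s by apply: H; rewrite occN_node mem_head.
by rewrite hv; congr plug; apply: set_nth_default; rewrite Hsz index_mem.
Qed.

End FullSubstitution.

Lemma plug_rn V W T (g : V -> W) (cs : seq (tree (sym V T))) t :
  tree_map (rn g) (plug cs t) =
  plug (map (tree_map (rn g)) cs) (tree_map (rn g) t).
Proof.
elim/tree_ind_all: t => c ts IH /=.
have E: map (tree_map (rn g)) (map (plug cs) ts) =
  map (plug (map (tree_map (rn g)) cs)) (map (tree_map (rn g)) ts).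
  by rewrite -!map_comp; apply: allProp_map_eq.
case: c => [v|a|i] /=; rewrite ?E //.
case: (ltnP i (size cs)) => hi; first by rewrite (nth_map (Node (Vr i) ts)).
by rewrite !nth_default ?size_map.
Qed.

Lemma bsub_rn (V W : eqType) T (g : V -> W) (U : V -> tree (sym V T)) U' t :
  {in occN t, forall v, U' (g v) = tree_map (rn g) (U v)} ->
  tree_map (rn g) (bsub U t) = bsub U' (tree_map (rn g) t).
Proof.
elim/tree_ind_all: t => c ts IH H /=.
have {}IH: map (tree_map (rn g)) (map (bsub U) ts) =
    map (bsub U') (map (tree_map (rn g)) ts).
  have {}H: {in occN_forest ts, forall v, U' (g v) = tree_map (rn g) (U v)}.
    by move=> v hv; apply: H; rewrite occN_node mem_cat hv orbT.
  elim: ts IH H => //= t ts IHts [IHt IH] H; congr (_ :: _).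
    by apply: IHt => v hv; apply: H; rewrite occN_forest_cons mem_cat hv.
  by apply: IHts => // v hv; apply: H; rewrite occN_forest_cons mem_cat hv orbT.
case: c H => [v|a|i] H /=; rewrite ?IH //.
by rewrite plug_rn IH H // occN_node mem_head.
Qed.

(** * Substitution preserves ranks and linearity of variables *)

Section Patterns.
Variables (V : eqType) (T : Type) (rkN : V -> nat) (rk : T -> nat).
Implicit Types (t g : tree (sym V T)) (cs : seq (tree (sym V T))).
Notation rkd := (ranked (sym_rk rkN rk)).

Lemma ranked_var i ts : rkd (Node (Vr i) ts) -> ts = [::].
Proof. by move=> /= /andP[/eqP/size0nil]. Qed.

Lemma vars_ranked_var i ts : rkd (Node (Vr i) ts) -> vars (Node (Vr i : sym V T) ts) =
  [:: i].
Proof. by move=> /ranked_var ->. Qed.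

Lemma ranked_plug cs g : rkd g -> all rkd cs ->
  {in vars g, forall i, i < size cs} -> rkd (plug cs g).
Proof.
move=> Hg Hcs; elim/tree_ind_all: g Hg => c ts IH Hr Hv.
have Hn: rkd (Node c (map (plug cs) ts)).
  move: Hr => /= /andP[Hsz Hr]; rewrite size_map Hsz /=.
  have {}Hv: {in flatten (map (@vars V T) ts), forall i, i < size cs}.
    by move=> i hi; apply: Hv; rewrite vars_node mem_cat hi orbT.
  elim: ts IH Hr Hv {Hsz} => //= t ts IHts [IHt IH] /andP[h1 h2] Hv.
  rewrite IHt ?IHts // => i hi; apply: Hv; rewrite mem_cat hi ?orbT //.
case: c Hr Hv Hn {IH} => [v|a|i] Hr Hv Hn //.
by rewrite /=; apply: (all_nthP _ Hcs); apply: Hv; rewrite vars_ranked_var ?mem_head.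
Qed.

Lemma vars_plug d cs g : rkd g -> {in vars g, forall i, i < size cs} ->
  vars (plug cs g) = flatten [seq vars (nth d cs i) | i <- vars g].
Proof.
elim/tree_ind_all: g => c ts IH Hr Hv.
have Hn: flatten (map (@vars V T) (map (plug cs) ts)) =
   flatten [seq vars (nth d cs i) | i <- flatten (map (@vars V T) ts)].
  move: Hr => /= /andP[Hsz Hr].
  have {}Hv: {in flatten (map (@vars V T) ts), forall i, i < size cs}.
    by move=> i hi; apply: Hv; rewrite vars_node mem_cat hi orbT.
  elim: ts IH Hr Hv {Hsz} => //= t ts IHts [IHt IH] /andP[h1 h2] Hv.
  rewrite map_cat flatten_cat IHt ?IHts // => i hi; apply: Hv; rewrite mem_cat hi ?orbT //.
case: c Hr Hv Hn {IH} => [v|a|i] Hr Hv Hn; rewrite /= ?vars_node //=.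
rewrite (ranked_var Hr) /= cats0 (set_nth_default d) //.
by apply: Hv; rewrite vars_ranked_var ?mem_head.
Qed.

Lemma occN_plug cs g : occN_forest cs = [::] -> occN g = [::] -> occN (plug cs g) = [::].
Proof.
move=> Hcs; elim/tree_ind_all: g => c ts IH.
case: c => [v|a|i]; rewrite occN_node //= => Hg.
  rewrite occN_node /=; elim: ts IH Hg => //= t ts IHts [IHt IH].
  rewrite !occN_forest_cons; case E: (occN t) => // /= Hg.
  by rewrite IHt // IHts.
case: (ltnP i (size cs)) => hi; last by rewrite nth_default // occN_node.
move: (Node _ _) => d.
elim: cs i hi Hcs {IH Hg} => //= t' cs IHc [|i] hi; rewrite occN_forest_cons /=;
  case E: (occN t') => //= H.
by rewrite IHc.
Qed.

(** The shape of what a nonterminal of rank k generates: a pattern with all nonterminals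
    replaced. *)
Definition tpattern k g := pattern rkN rk k g /\ occN g = [::].

Lemma occN_bsub U t : {in occN t, forall v, occN (U v) = [::]} -> occN (bsub U t) = [::].
Proof.
elim/tree_ind_all: t => c ts IH H.
have {}IH: occN_forest (map (bsub U) ts) = [::].
  have {}H: {in occN_forest ts, forall v, occN (U v) = [::]}.
    by move=> v hv; apply: H; rewrite occN_node mem_cat hv orbT.
  elim: ts IH H => //= t ts IHts [IHt IH] H; rewrite occN_forest_cons IHt ?IHts // =>
    v hv; apply: H;
   by rewrite occN_forest_cons mem_cat hv ?orbT.
case: c H => [v|a|i] H /=; rewrite ?occN_node //=.
by apply: occN_plug => //; apply: H; rewrite occN_node mem_head.
Qed.

(** As [g] uses every variable exactly once, each tree of [cs] is copied exactly once, so variables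
    are only permuted. *)
Lemma pattern_plug cs g : pattern rkN rk (size cs) g -> all rkd cs ->
  rkd (plug cs g) /\ perm_eq (vars (plug cs g)) (flatten (map (@vars V T) cs)).
Proof.
case/andP=> Hr Hp Hcs.
have Hv: {in vars g, forall i, i < size cs}.
  by move=> i; rewrite (perm_mem Hp) mem_iota.
split; first exact: ranked_plug.
case: cs Hp Hcs Hv => [|d cs] Hp Hcs Hv.
  by rewrite (vars_plug g) //; move/perm_nilP: Hp => ->.
rewrite (vars_plug d) //.
apply: perm_trans (perm_flatten (perm_map _ Hp)) _.
suff -> : [seq vars (nth d (d :: cs) i) | i <- iota 0 (size (d :: cs))] =
    map (@vars V T) (d :: cs) by [].
by rewrite -[in RHS](mkseq_nth d (d :: cs)) -map_comp.
Qed.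

Lemma ranked_bsub U t :
  {in occN t, forall v, pattern rkN rk (rkN v) (U v)} -> rkd t ->
  rkd (bsub U t) /\ perm_eq (vars (bsub U t)) (vars t).
Proof.
elim/tree_ind_all: t => c ts IH H.
have {}IH: all rkd ts -> all rkd (map (bsub U) ts) /\
   perm_eq (flatten (map (@vars V T) (map (bsub U) ts))) (flatten (map (@vars V T) ts)).
  have {}H: {in occN_forest ts, forall v, pattern rkN rk (rkN v) (U v)}.
    by move=> v hv; apply: H; rewrite occN_node mem_cat hv orbT.
  elim: ts IH H => //= t ts IHts [IHt IH] H /andP[h1 h2].
  have [|//|r1 p1] := IHt.
    by move=> v hv; apply: H; rewrite occN_forest_cons mem_cat hv ?orbT.
  have [//||//|r2 p2] := IHts.
    by move=> v hv; apply: H; rewrite occN_forest_cons mem_cat hv ?orbT.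
  by rewrite r1 r2; split=> //; apply: perm_cat.
move=> /= /andP[/eqP Hs /IH[r p]].
case: c H Hs => [v|a|i] H Hs /=; rewrite ?vars_node ?size_map ?Hs ?eqxx ?r /=;
  try by split; rewrite // perm_cons.
have Hp := H v; rewrite occN_node mem_head in Hp; have {}Hp := Hp isT.
have {}Hp: pattern rkN rk (size (map (bsub U) ts)) (U v) by rewrite size_map Hs.
by have [r1 p1] := pattern_plug Hp r; split=> //; apply: perm_trans p1 p.
Qed.

Lemma tpattern_bsub U t k : {in occN t, forall v, tpattern (rkN v) (U v)} ->
  pattern rkN rk k t -> tpattern k (bsub U t).
Proof.
move=> H /andP[Hr Hp]; split; last by apply: occN_bsub => v hv; case: (H v hv).
have [|//|r p] := @ranked_bsub U t; first by move=> v hv; case: (H v hv).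
by rewrite /pattern r (perm_trans p).
Qed.

End Patterns.

Lemma pattern_rn (V W : eqType) T (g : V -> W) rkN rkN' (rk : T -> nat) k t :
  {in occN t, forall v, rkN' (g v) = rkN v} ->
  pattern rkN' rk k (tree_map (rn g) t) = pattern rkN rk k t.
Proof.
move=> H; rewrite /pattern vars_rn; congr (_ && _).
elim/tree_ind_all: t H => c ts IH H /=; rewrite size_map.
have -> : sym_rk rkN' rk (rn g c) = sym_rk rkN rk c.
  by case: c H {IH} => //= v H; apply: H; rewrite occN_node mem_head.
congr (_ && _).
have {}H: {in occN_forest ts, forall v, rkN' (g v) = rkN v}.
  by move=> v hv; apply: H; rewrite occN_node mem_cat hv orbT.
elim: ts IH H => //= t ts IHts [IHt IH] H; rewrite IHt ?IHts // => v hv; apply: H;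
   by rewrite occN_forest_cons mem_cat hv ?orbT.
Qed.

(** Neither variables nor nonterminals are left, so all labels are terminals. *)
Lemma emb_of_tpattern (V T : eqType) rkN (rk : T -> nat) (t : tree (sym V T)) :
  tpattern rkN rk 0 t -> exists t0, t = emb V t0.
Proof.
case=> /andP[_ /perm_nilP Hv] HN.
elim/tree_ind_all: t Hv HN => c ts IH; rewrite vars_node occN_node.
case: c => [//|a|//] /= Hv HN.
suff [ts0 ->]: exists ts0, ts = map (@emb V T) ts0 by exists (Node a ts0).
elim: ts IH Hv HN => [|t ts IHts] /=; first by exists [::].
rewrite occN_forest_cons => -[IHt IH].
case E: (vars t) => //= Hv; case E': (occN t) => //= HN.
have [t0 ->] := IHt E E'; have [ts0 ->] := IHts IH Hv HN.
by exists (t0 :: ts0).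
Qed.

Lemma emb_inj (V T : eqType) : injective (@emb V T).
Proof.
move=> t t'; elim/tree_ind_all: t t' => a ts IH [a' ts'] /= [-> E]; congr Node.
elim: ts IH ts' E => [|t ts IHts] /= IH [|t' ts'] //= [].
by case: IH => IHt IH /IHt -> /(IHts IH) ->.
Qed.

Lemma rn_emb (V W T : eqType) (g : V -> W) (t : tree T) : tree_map (rn g) (emb V t) =
  emb W t.
Proof. by rewrite /emb tree_map_comp; apply: tree_map_ext. Qed.

(** * Reading the input word along a tree *)

(* An annotation [y] of a nonterminal of rank k describes how a pattern reads *)
(* the input word: [y 0] holds the positions at which the pattern is entered  *)
(* and left, [y j.+1] the positions before and after the variable x_(j+1).    *)
(* The variables need not occur in increasing order.                          *)
Definition ann := nat -> nat * nat.

Section Thread.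
Variables (A : Type) (r : A -> nat -> nat -> Prop).

(** Reading the subtrees below a terminal: each starts where the previous one ends. *)
Fixpoint thread (ts : seq A) s e : Prop :=
  if ts is t :: ts' then exists2 m, r t s m & thread ts' m e else s = e.

(** Reading the subtrees below a nonterminal: the order of the variables in the pattern to be
    substituted is unknown, so each subtree is read between its own two positions. *)
Fixpoint fan (y : ann) (ts : seq A) i : Prop :=
  if ts is t :: ts' then r t (y i).1 (y i).2 /\ fan y ts' i.+1 else True.

End Thread.

Definition bounded n (p : nat * nat) := (p.1 <= n) && (p.2 <= n).

Section Run.
Variables (T : eqType) (rk : T -> nat) (w : seq T) (D : pred T).

Section Def.
Variable V : Type.

(* [run x al t s e]: the prefix traversal of t, comparing the letters in D    *)
(* with w, leads from position s to position e, where the variables are       *)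
(* crossed as prescribed by x and the nonterminals as prescribed by al.       *)
Fixpoint run (x : ann) (al : V -> ann) (t : tree (sym V T)) (s e : nat) : Prop :=
  let: Node c ts := t in
  match c with
  | Tm a => if D a then onth w s = Some a /\ thread (run x al) ts s.+1 e
            else thread (run x al) ts s e
  | Vr j => (s, e) = x j.+1
  | Nt C => (s, e) = al C 0 /\ fan (run x al) (al C) ts 1
  end.

End Def.

(* A dummy: values contain no nonterminal. *)
Definition noal (V : Type) : V -> ann := fun _ _ => (0, 0).

(** The invariant attached to an annotated nonterminal: pair 0 supplies the endpoints of the run,
    the others the crossings of the variables. *)
Definition reads (V : Type) (y : ann) (t : tree (sym V T)) :=
  run y (@noal V) t (y 0).1 (y 0).2.

Variable V : eqType.
Variable rkN : V -> nat.
Implicit Types (t g : tree (sym V T)) (x y : ann) (al : V -> ann).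
Notation rkd := (ranked (sym_rk rkN rk)).

(** A run consults only pairs of variables and nonterminals that occur. This is what allows
    annotations chosen for disjoint parts of a tree to be glued. *)
Lemma run_ext x x' al al' t s e : rkd t ->
  {in vars t, forall j, x j.+1 = x' j.+1} ->
  {in occN t, forall C i, i <= rkN C -> al C i = al' C i} ->
  run x al t s e -> run x' al' t s e.
Proof.
elim/tree_ind_all: t s e => c ts IH s e /= /andP[/eqP Hsz Hr] Hx Ha.
have {}Hx' : {in flatten (map (@vars V T) ts), forall j, x j.+1 = x' j.+1}.
  by move=> v hv; apply: Hx; rewrite vars_node mem_cat hv orbT.
have {}Ha' : {in occN_forest ts, forall C i, i <= rkN C -> al C i = al' C i}.
  by move=> v hv; apply: Ha; rewrite occN_node mem_cat hv orbT.
have Hth : forall s e, thread (run x al) ts s e -> thread (run x' al') ts s e.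
  elim: ts IH {Hsz Hx Ha} Hr Hx' Ha' => //= t ts IHts [IHt IH] /andP[h1 h2] Hx Ha s0 e0 [m h3 h4].
  exists m.
    by apply: (IHt _ _ h1 _ _ h3) => v hv; [apply: Hx|apply: Ha];
      rewrite ?occN_forest_cons mem_cat hv.
  by apply: (IHts _ _ _ _ _ _ h4) => // v hv; [apply: Hx|apply: Ha];
    rewrite ?occN_forest_cons mem_cat hv orbT.
case: c Hsz Hx Ha => [C|a|j] Hsz Hx Ha.
- have HC: C \in occN (Node (Nt C : sym V T) ts) by rewrite occN_node mem_head.
  case=> -> Hf; split; first exact: Ha.
  have {Ha} HaC := Ha C HC.
  have Hi: size ts + 1 <= (rkN C).+1 by rewrite Hsz addn1.
  elim: ts 1 IH {Hsz Hth HC Hx} Hr Hx' Ha' Hi Hf =>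
    //= t ts IHts i [IHt IH] /andP[h1 h2] Hx Ha' Hi [h3 h4].
  have hi : i <= rkN C by rewrite -ltnS (leq_trans _ Hi) // addSn ltnS leq_addl.
  split.
    rewrite -HaC //.
    by apply: (IHt _ _ h1 _ _ h3) => v hv; [apply: Hx|apply: Ha'];
      rewrite ?occN_forest_cons mem_cat hv.
  apply: IHts => //; try by rewrite addnS -addSn.
  - by move=> v hv; apply: Hx; rewrite mem_cat hv orbT.
  - by move=> v hv; apply: Ha'; rewrite occN_forest_cons mem_cat hv orbT.
- by case: (D a) => [[h1 h2]|]; [split=> //|]; apply: Hth.
- by move=> ->; apply: Hx; rewrite vars_node mem_head.
Qed.

Lemma run_ext_all x x' al al' ts : all rkd ts ->
  {in flatten (map (@vars V T) ts), forall j, x j.+1 = x' j.+1} ->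
  {in occN_forest ts, forall C i, i <= rkN C -> al C i = al' C i} ->
  allProp (fun t => forall s e, run x al t s e -> run x' al' t s e) ts.
Proof.
elim: ts => //= t ts IH /andP[h1 h2] Hx Ha; split.
  by move=> s e; apply: run_ext => // v hv; [apply: Hx|apply: Ha];
     rewrite ?occN_forest_cons mem_cat hv.
by apply: IH => // v hv; [apply: Hx|apply: Ha]; rewrite ?occN_forest_cons mem_cat hv orbT.
Qed.

Lemma thread_imp A (r r' : A -> nat -> nat -> Prop) ts s e :
  allProp (fun a => forall s e, r a s e -> r' a s e) ts ->
  thread r ts s e -> thread r' ts s e.
Proof.
elim: ts s => //= t ts IH s [h1 h2] [m /h1 h3 h4]; exists m => //.
exact: IH.
Qed.

Lemma fan_imp A (r r' : A -> nat -> nat -> Prop) y ts i :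
  allProp (fun a => forall s e, r a s e -> r' a s e) ts ->
  fan r y ts i -> fan r' y ts i.
Proof.
by elim: ts i => //= t ts IH i [h1 h2] [/h1 h3 /(IH _ h2)].
Qed.

Lemma fanP A (r : A -> nat -> nat -> Prop) y d ts i :
  fan r y ts i <->
  forall j, j < size ts -> r (nth d ts j) (y (i + j)).1 (y (i + j)).2.
Proof.
elim: ts i => [|t ts IH] i //=; split.
  by case=> h1 /IH h2 [|j] hj; rewrite ?addn0 //= -addSnnS; apply: h2.
move=> H; split; first by have := H 0 isT; rewrite addn0.
by apply/IH => j hj; rewrite addSnnS; apply: (H j.+1).
Qed.

Lemma onth_lt (s : nat) a : onth w s = Some a -> s < size w.
Proof. by move=> E; rewrite -onthTE E. Qed.

(** The crossing of a variable in the run of [g] is replaced by a run of the plugged tree between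
    the same two positions. *)
Lemma run_plug d x al y cs g s e : rkd g -> occN g = [::] ->
  {in vars g, forall j, j < size cs /\
    run x al (nth d cs j) (y j.+1).1 (y j.+1).2} ->
  run y (@noal V) g s e -> run x al (plug cs g) s e.
Proof.
elim/tree_ind_all: g s e => c ts IH s e Hr; rewrite occN_node vars_node => HN Hv.
have Hth : forall s e, thread (run y (@noal V)) ts s e ->
  thread (run x al) (map (plug cs) ts) s e.
  have {}Hv : {in flatten (map (@vars V T) ts), forall j, j < size cs /\
    run x al (nth d cs j) (y j.+1).1 (y j.+1).2}.
    by move=> v hv; apply: Hv; rewrite mem_cat hv orbT.
  have {}HN : occN_forest ts = [::] by case: (c) HN.
  move: Hr => /= /andP[_].
  elim: ts IH HN Hv => //= t ts IHts [IHt IH]; rewrite occN_forest_cons.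
  case E: (occN t) => //= HN Hv /andP[h1 h2] s0 e0 [m h3 h4]; exists m.
    by apply: IHt => // v hv; apply: Hv; rewrite mem_cat hv.
  by apply: IHts => // v hv; apply: Hv; rewrite mem_cat hv orbT.
case: c Hr HN Hv {IH} => [C|a|j] Hr HN Hv //.
  by move=> /=; case: (D a) => [[h1 h2]|]; [split=> //|]; apply: Hth.
have [hj Hj] := Hv j (mem_head _ _).
by move: Hj => /=; case: (y j.+1) => s1 e1 /= Hj [-> ->]; rewrite (set_nth_default d).
Qed.

(** Soundness of annotations: at a nonterminal, [fan] provides exactly the runs of the subtrees that
    [run_plug] needs. *)
Lemma run_bsub x al U t s e : rkd t ->
  {in occN t, forall C, tpattern rkN rk (rkN C) (U C) /\ reads (al C) (U C)} ->
  run x al t s e -> run x (@noal V) (bsub U t) s e.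
Proof.
elim/tree_ind_all: t s e => c ts IH s e /= /andP[/eqP Hsz Hr] HU.
have {}IH : allProp (fun t => forall s e, run x al t s e ->
  run x (@noal V) (bsub U t) s e) ts.
  have {}HU : {in occN_forest ts, forall C,
    tpattern rkN rk (rkN C) (U C) /\ reads (al C) (U C)}.
    by move=> v hv; apply: HU; rewrite occN_node mem_cat hv orbT.
  elim: ts IH Hr HU {Hsz} => //= t ts IHts [IHt IH] /andP[h1 h2] HU; split.
    by move=> s0 e0; apply: IHt => // v hv; apply: HU; rewrite occN_forest_cons mem_cat hv.
  by apply: IHts => // v hv; apply: HU; rewrite occN_forest_cons mem_cat hv orbT.
have Hth : forall s e, thread (run x al) ts s e ->
  thread (run x (@noal V)) (map (bsub U) ts) s e.
  move=> s0 e0 /(thread_imp IH); elim: ts {IH Hsz Hr HU} s0 => //= t ts IHts s0 [m h1 h2].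
  by exists m => //; apply: IHts.
case: c Hsz HU => [C|a|j] Hsz HU //=; last first.
  by case: (D a) => [[h1 h2]|]; [split=> //|]; apply: Hth.
have HC : C \in occN (Node (Nt C : sym V T) ts) by rewrite occN_node mem_head.
have [[/andP[Hp1 Hp2] HN] Hread] := HU C HC.
case=> HsE /(fan_imp IH) /fanP Hf; move: HsE Hread; rewrite /reads; case: (al C 0) =>
  _ _ [<- <-] /=.
apply: (@run_plug (bsub U (U C))) => // j.
rewrite (perm_mem Hp2) mem_iota /= add0n size_map Hsz => hj; split=> //.
by rewrite (nth_map (U C)) ?Hsz //; apply: Hf; rewrite Hsz.
Qed.

(** Inverse of [run_plug]: the pair of a variable is read off at its only occurrence. The bound is
    carried along because positions advance only past letters found in [w]. *)
Lemma run_unplug d x al cs g s e : rkd g -> occN g = [::] -> uniq (vars g) ->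
  {in vars g, forall j, j < size cs} ->
  (forall j s e, j < size cs -> s <= size w ->
    run x al (nth d cs j) s e -> e <= size w) ->
  s <= size w -> run x al (plug cs g) s e ->
  e <= size w /\ exists2 y, run y (@noal V) g s e &
   {in vars g, forall j, bounded (size w) (y j.+1) /\
      run x al (nth d cs j) (y j.+1).1 (y j.+1).2}.
Proof.
move=> Hr HN Hu Hv Hb; elim/tree_ind_all: g s e Hr HN Hu Hv => c ts IH s e Hr HN Hu Hv.
have Hth : forall s e, s <= size w -> thread (run x al) (map (plug cs) ts) s e ->
  e <= size w /\ exists2 y, thread (run y (@noal V)) ts s e &
   {in flatten (map (@vars V T) ts), forall j, bounded (size w) (y j.+1) /\
      run x al (nth d cs j) (y j.+1).1 (y j.+1).2}.
  move: HN Hu Hv Hr; rewrite occN_node vars_node => HN Hu Hv /= /andP[_ Hr].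
  have {}Hv : {in flatten (map (@vars V T) ts), forall j, j < size cs}.
    by move=> v hv; apply: Hv; rewrite mem_cat hv orbT.
  have {}HN : occN_forest ts = [::] by case: (c) HN.
  have {}Hu : uniq (flatten (map (@vars V T) ts)) by move: Hu; rewrite cat_uniq => /and3P[].
  elim: ts IH HN Hu Hv Hr => /= [|t ts IHts]; first by move=> _ _ _ _ _ s0 e0 h <-;
    split=> //; exists (noal 0).
  case=> IHt IH; rewrite occN_forest_cons cat_uniq; case E: (occN t) =>
    //= HN /and3P[u1 /hasPn u2 u3] Hv /andP[h1 h2] s0 e0 h0 [m h3 h4].
  have [|hm [y1 hy1 Hy1]] := IHt s0 m h1 E u1 _ h0 h3.
    by move=> v hv; apply: Hv; rewrite mem_cat hv.
  have [|he [y2 hy2 Hy2]] := IHts IH HN u3 _ h2 m e0 hm h4.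
    by move=> v hv; apply: Hv; rewrite mem_cat hv orbT.
  (* The predecessor appears because variable j has its pair at index j + 1. *)
  split=> //; pose y i := if i.-1 \in vars t then y1 i else y2 i.
  have Ey1 : {in vars t, forall j, y1 j.+1 = y j.+1} by move=> j hj; rewrite /y /= hj.
  have Ey2 : {in flatten (map (@vars V T) ts), forall j, y2 j.+1 = y j.+1}.
    by move=> j hj; rewrite /y /= (negbTE (u2 j hj)).
  exists y.
    exists m; first by apply: run_ext hy1 => //; rewrite E.
    by apply: thread_imp hy2; apply: run_ext_all => //; rewrite HN.
  by move=> j; rewrite mem_cat => /orP[hj|hj]; [rewrite -Ey1 //;
    apply: Hy1|rewrite -Ey2 //; apply: Hy2].
case: c Hr HN Hu Hv {IH} => [C|a|j] Hr HN Hu Hv hs; first by rewrite occN_node in HN.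
  rewrite vars_node /=; case: (D a) => [[h1 h2]|]; last exact: Hth.
  have [he [y hy Hy]] := Hth _ _ (onth_lt h1) h2.
  by split=> //; exists y.
have hj: j < size cs by apply: Hv; rewrite vars_node mem_head.
rewrite (vars_ranked_var Hr) /= (set_nth_default d) // => H.
have he := Hb _ _ _ hj hs H.
split=> //; exists (fun => (s, e)) => // i; rewrite inE => /eqP ->.
by rewrite /bounded hs he.
Qed.

(** Completeness of annotations, inverse of [run_bsub]: the annotation of a nonterminal is obtained
    by [run_unplug] at its only occurrence, and those of disjoint subtrees are glued. *)
Lemma run_unbsub x U t s e : rkd t -> uniq (occN t) ->
  {in occN t, forall C, tpattern rkN rk (rkN C) (U C)} ->
  {in vars t, forall j, bounded (size w) (x j.+1)} ->
  s <= size w -> run x (@noal V) (bsub U t) s e ->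
  e <= size w /\ exists2 al, run x al t s e & {in occN t, forall C,
     (forall i, i <= rkN C -> bounded (size w) (al C i)) /\ reads (al C) (U C)}.
Proof.
elim/tree_ind_all: t s e => c ts IH s e Hrk Hu HU Hx.
have /andP[/eqP Hsz Hr] : (size ts == sym_rk rkN rk c) && all rkd ts := Hrk; clear Hrk.
move: (Hu); rewrite occN_node cat_uniq => /and3P[_ Hd Hu'].
have HU' : {in occN_forest ts, forall C, tpattern rkN rk (rkN C) (U C)}.
  by move=> v hv; apply: HU; rewrite occN_node mem_cat hv orbT.
have Hx' : {in flatten (map (@vars V T) ts), forall j, bounded (size w) (x j.+1)}.
  by move=> v hv; apply: Hx; rewrite vars_node mem_cat hv orbT.
have {}IH : allProp (fun t => forall s e, s <= size w -> run x (@noal V) (bsub U t) s e ->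
    e <= size w /\ exists2 al, run x al t s e & {in occN t, forall C,
     (forall i, i <= rkN C -> bounded (size w) (al C i)) /\ reads (al C) (U C)}) ts.
  elim: ts IH Hr HU' Hu' Hx' {Hsz Hd Hu HU Hx} => //= t ts IHts [IHt IH] /andP[h1 h2] HU.
  rewrite occN_forest_cons cat_uniq => /and3P[u1 _ u2] Hx; split.
    by move=> s0 e0; apply: IHt => // v hv; [apply: HU|apply: Hx];
      rewrite ?occN_forest_cons mem_cat hv.
  by apply: IHts => // v hv; [apply: HU|apply: Hx];
    rewrite ?occN_forest_cons mem_cat hv orbT.
have Hth : forall s e, s <= size w -> thread (run x (@noal V)) (map (bsub U) ts) s e ->
    e <= size w /\ exists2 al, thread (run x al) ts s e & {in occN_forest ts, forall C,
     (forall i, i <= rkN C -> bounded (size w) (al C i)) /\ reads (al C) (U C)}.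
  elim: ts IH Hr Hu' {Hsz Hd Hu HU Hx HU' Hx'} => [|t ts IHts] /=.
    by move=> _ _ _ s0 e0 h0 <-; split=> //; exists (@noal V).
  rewrite occN_forest_cons cat_uniq => -[IHt IH] /andP[h1 h2] /and3P[u1 /hasPn u2 u3] s0 e0 h0 [m h3 h4].
  have [hm [a1 ha1 Ha1]] := IHt _ _ h0 h3.
  have [he [a2 ha2 Ha2]] := IHts IH h2 u3 _ _ hm h4.
  split=> //; pose al C := if C \in occN t then a1 C else a2 C.
  have E1 : {in occN t, forall C, a1 C = al C} by move=> C hC; rewrite /al hC.
  have E2 : {in occN_forest ts, forall C, a2 C = al C} by move=> C hC;
    rewrite /al (negbTE (u2 C hC)).
  exists al.
    exists m; first by apply: run_ext ha1 => // C /E1 ->.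
    by apply: thread_imp ha2; apply: run_ext_all => // C /E2 ->.
  by move=> C; rewrite mem_cat => /orP[hC|hC]; [rewrite -E1 //;
    apply: Ha1|rewrite -E2 //; apply: Ha2].
(* Below a nonterminal the starting positions come from [y] rather than from the preceding subtree,
   so they must be assumed bounded. *)
have Hfan : forall y i, (forall j, j < size ts -> (y (i + j)).1 <= size w) ->
   fan (run x (@noal V)) y (map (bsub U) ts) i ->
   exists2 al, fan (run x al) y ts i & {in occN_forest ts, forall C,
     (forall i, i <= rkN C -> bounded (size w) (al C i)) /\ reads (al C) (U C)}.
  elim: ts IH Hr Hu' {Hsz Hd Hu HU Hx HU' Hx' Hth} => [|t ts IHts] /=.
    by move=> *; exists (@noal V).
  rewrite occN_forest_cons cat_uniq => -[IHt IH] /andP[h1 h2] /and3P[u1 /hasPn u2 u3] y i Hy [h3 h4].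
  have [|hm [a1 ha1 Ha1]] := IHt _ _ _ h3; first by have := Hy 0 isT; rewrite addn0.
  have [|a2 ha2 Ha2] := IHts IH h2 u3 _ _ _ h4; first by move=> j hj; rewrite addSnnS;
    apply: Hy.
  pose al C := if C \in occN t then a1 C else a2 C.
  have E1 : {in occN t, forall C, a1 C = al C} by move=> C hC; rewrite /al hC.
  have E2 : {in occN_forest ts, forall C, a2 C = al C} by move=> C hC;
    rewrite /al (negbTE (u2 C hC)).
  exists al.
    split; first by apply: run_ext ha1 => // C /E1 ->.
    by apply: fan_imp ha2; apply: run_ext_all => // C /E2 ->.
  by move=> C; rewrite mem_cat => /orP[hC|hC]; [rewrite -E1 //;
    apply: Ha1|rewrite -E2 //; apply: Ha2].
case: c Hsz Hd Hu HU Hx => [C|a|j] Hsz Hd Hu HU Hx hs; last first.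
- move=> /= E; have := Hx j; rewrite vars_node mem_head => /(_ isT); rewrite -E =>
    /andP[_ he].
  by split=> //; exists (@noal V) => //; rewrite (size0nil Hsz).
- rewrite /=; case: (D a) => [[h1 h2]|]; last exact: Hth.
  have [he [al hal Hal]] := Hth _ _ (onth_lt h1) h2.
  by split=> //; exists al.
have HC: C \in occN (Node (Nt C : sym V T) ts) by rewrite occN_node mem_head.
have [/andP[Hp1 Hp2] HN] := HU C HC.
have Hv : {in vars (U C), forall j, j < size (map (bsub U) ts)}.
  by move=> j; rewrite (perm_mem Hp2) mem_iota /= size_map Hsz.
move=> H.
have [|||he [y hy Hy]] := @run_unplug (bsub U (U C)) x (@noal V) _ _ s e Hp1 HN _ Hv _ _ H => //.
- by rewrite (perm_uniq Hp2) iota_uniq.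
- move=> j s0 e0; rewrite size_map => hj h0; rewrite (nth_map (U C)) //.
  have := hj; clear -h0 IH; elim: ts j IH => //= t ts IHts [|j] [IHt IH] hj;
    last exact: IHts.
  by case/(IHt _ _ h0).
split=> //.
have {}Hy j : j < rkN C -> bounded (size w) (y j.+1) /\
      run x (@noal V) (nth (bsub U (U C)) (map (bsub U) ts) j) (y j.+1).1 (y j.+1).2.
  by move=> hj; apply: Hy; rewrite (perm_mem Hp2) mem_iota.
have [||al hal Hal] := Hfan y 1.
- by move=> j; rewrite Hsz => /Hy[/andP[]].
- by apply/(fanP _ _ (bsub U (U C))) => j; rewrite size_map Hsz => /Hy[].
(* [run_unplug] determines only the pairs of the variables; pair 0 is the entry and exit of the
   whole subtree. *)
pose yC i := if i is j.+1 then y j.+1 else (s, e).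
exists (fun v => if v == C then yC else al v).
  rewrite /= eqxx; split=> //.
  have {}hal : fan (run x al) yC ts 1.
    by apply/(fanP _ _ (U C)) => j hj; have /(fanP _ _ (U C))/(_ j hj) := hal.
  apply: fan_imp hal; apply: run_ext_all => // v hv i _.
  case: eqP => // E; move: Hd; rewrite E in hv.
  by case/hasP; exists C; rewrite ?inE.
move=> v; rewrite inE /=; case: eqP => [-> _|_ /= hv]; last exact: Hal.
split; first by case=> [_|j /Hy[]//]; rewrite /bounded hs he.
by apply: run_ext hy => //; rewrite HN.
Qed.

Lemma reads_ext k y y' t : tpattern rkN rk k t ->
  (forall i, i <= k -> y i = y' i) -> reads y t -> reads y' t.
Proof.
case=> /andP[Hr Hp] HN E; rewrite /reads -E //; apply: run_ext => //.
by move=> j; rewrite (perm_mem Hp) mem_iota => hj; apply: E.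
Qed.

Lemma drop_onth s a (u : seq T) :
  (onth w s = Some a /\ prefix u (drop s.+1 w)) <-> prefix (a :: u) (drop s w).
Proof.
elim: w s => [|b w' IH] [|s] //=; try by split=> [[]|].
by rewrite drop0; split=> [[[->] ->]|/andP[/eqP -> ->]]; rewrite ?eqxx.
Qed.

(** Without variables and nonterminals nothing is prescribed: the run just matches the yield with
    the part of [w] starting at [s]. *)
Lemma run_emb x al (t : tree T) s e : run x al (emb V t) s e <->
  e = s + size [seq a <- preorder t | D a] /\
  prefix [seq a <- preorder t | D a] (drop s w).
Proof.
elim/tree_ind_all: t s e => a ts IH s e /=.
have Hth s0 : thread (run x al) (map (@emb V T) ts) s0 e <->
    e = s0 + size (filter D (flatten (map (@preorder T) ts))) /\
    prefix (filter D (flatten (map (@preorder T) ts))) (drop s0 w).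
  elim: ts IH s0 => [|t ts IHts] IH s0 /=.
    by rewrite prefix0s addn0; split=> [->|[]].
  case: IH => IHt /IHts {}IH.
  rewrite filter_cat size_cat addnA; set f1 := filter _ _; set f2 := filter _ _.
  have Hpre : prefix (f1 ++ f2) (drop s0 w) =
    prefix f1 (drop s0 w) && prefix f2 (drop (s0 + size f1) w).
    rewrite addnC -drop_drop; apply/prefixP/andP => [[u ->]|[/prefixP[u ->]]].
      by rewrite -catA prefix_prefix drop_size_cat // prefix_prefix.
    by rewrite drop_size_cat // => /prefixP[u' ->]; exists u'; rewrite catA.
  rewrite Hpre; split.
    by case=> m /IHt[-> h1] /IH[-> h2]; rewrite h1.
  case=> E /andP[h1 h2]; exists (s0 + size f1); first by apply/IHt.
  by apply/IH.
case: (D a); last exact: Hth.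
have [H1 H2] := Hth s.+1; split=> [[h1 h2]|/= [E /drop_onth[h1 h2]]].
  have [-> h3] := H1 h2; rewrite /= addnS; split=> //.
  by apply/drop_onth.
by split=> //; apply: H2; rewrite E addnS.
Qed.

End Run.

(** * Derivations and values *)

Section SeqFacts.
Variables (A B : eqType).
Implicit Types (s : seq A) (u : seq B).

Lemma uniq_flatten (ss : seq (seq A)) : uniq ss ->
  (forall s, s \in ss -> uniq s) ->
  {in ss &, forall s s', s != s' -> ~~ has (mem s) s'} -> uniq (flatten ss).
Proof.
elim: ss => //= s ss IH /andP[Hs Hu] H1 H2.
rewrite cat_uniq H1 ?mem_head // IH //=; last 2 first.
- by move=> s' hs; apply: H1; rewrite inE hs orbT.
- by move=> s1 s2 h1 h2; apply: H2; rewrite inE ?h1 ?h2 orbT.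
rewrite andbT; apply/hasPn => x /flattenP[s' hs' hx]; apply/negP => hx'.
have /hasPn/(_ x hx) : ~~ has (mem s) s'.
  by apply: H2; rewrite ?mem_head ?inE ?hs' ?orbT //; apply: contraNneq Hs => ->.
by rewrite /= hx'.
Qed.

(** For a repetition-free [s], the zip is the graph of a function on [s]. *)
Lemma mem_zip_uniq d s u a b : uniq s -> size s = size u ->
  ((a, b) \in zip s u) = (a \in s) && (b == nth d u (index a s)).
Proof.
elim: s u => [|x s IH] [|y u] //= /andP[Hx Hu] [E].
rewrite !in_cons xpair_eqE [x == a]eq_sym IH //.
by case: eqP => [->|] //=; rewrite (negbTE Hx) /= orbF.
Qed.

Lemma mem_zip1 s u a b : (a, b) \in zip s u -> a \in s.
Proof.
elim: s u => [|x s IH] [|y u] //=; rewrite !inE => /orP[/eqP[-> _]|/IH ->];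
 by rewrite ?eqxx ?orbT.
Qed.

Lemma mem_zip2 s u a b : (a, b) \in zip s u -> b \in u.
Proof.
elim: s u => [|x s IH] [|y u] //=; rewrite !inE => /orP[/eqP[_ ->]|/IH ->];
 by rewrite ?eqxx ?orbT.
Qed.

End SeqFacts.

Lemma mem_zip_map (A B A' B' : eqType) (g : A -> A') (h : B -> B') s u a b :
  (a, b) \in zip s u -> (g a, h b) \in zip (map g s) (map h u).
Proof.
elim: s u => [|x s IH] [|y u] //=; rewrite !inE.
by move=> /orP[/eqP[-> ->]|/IH ->]; rewrite ?eqxx ?orbT.
Qed.

Lemma mem_zip_mapl (A B A' : eqType) (g : A -> A') (s : seq A) (u : seq B) a' b :
  (a', b) \in zip (map g s) u -> exists2 a, (a, b) \in zip s u & a' = g a.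
Proof.
elim: s u => [|x s IH] [|y u] //=; rewrite !inE.
move=> /orP[/eqP[-> ->]|/IH[a ha ->]]; first by exists x; rewrite ?mem_head.
by exists a; rewrite // inE ha orbT.
Qed.

Lemma mem_zip_mapr (A B B' : eqType) (h : B -> B') (s : seq A) (u : seq B) a b' :
  (a, b') \in zip s (map h u) -> exists2 b, (a, b) \in zip s u & b' = h b.
Proof.
elim: s u => [|x s IH] [|y u] //=; rewrite !inE.
move=> /orP[/eqP[-> ->]|/IH[b hb ->]]; first by exists y; rewrite ?mem_head.
by exists b; rewrite // inE hb orbT.
Qed.

Lemma mem_occN_forest (V T : eqType) (u : seq (tree (sym V T))) t C :
  t \in u -> C \in occN t -> C \in occN_forest u.
Proof. by move=> ht hC; apply/flattenP; exists (occN t) => //; apply: map_f. Qed.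

Lemma uniq_occN (V T : eqType) (u : seq (tree (sym V T))) t :
  uniq (occN_forest u) -> t \in u -> uniq (occN t).
Proof.
elim: u => // t' u IH; rewrite occN_forest_cons cat_uniq => /and3P[h1 _ h2].
by rewrite inE => /orP[/eqP ->|/(IH h2)].
Qed.

(** * Substitution of links as a function on nonterminals *)

Section Links.
Variables (V T : eqType).
Implicit Types (L : seq (seq V)) (f : seq V -> seq (tree (sym V T))).

(** The tree that a simultaneous substitution of big nonterminals assigns to a single
    nonterminal. *)
Definition lnk L f (C : V) : tree (sym V T) :=
  nth (Node (Vr 0) [::]) (flatten (map f L)) (index C (flatten L)).

Lemma size_flatten_map L f : {in L, forall B, size (f B) = size B} ->
  size (flatten (map f L)) = size (flatten L).
Proof.
elim: L => //= B L IH H; rewrite !size_cat H ?mem_head // IH //.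
by move=> B' hB; apply: H; rewrite inE hB orbT.
Qed.

Lemma subst_linksE L f u : {in L, forall B, size (f B) = size B} ->
  {subset occN_forest u <= flatten L} ->
  subst_links L f u = map (bsub (lnk L f)) u.
Proof.
move=> Hsz Hs; apply/eq_in_map => t ht.
apply: subst_bsub; first exact: size_flatten_map.
by move=> C hC; apply: Hs; apply: mem_occN_forest hC.
Qed.

Lemma zip_flatten_map L f : {in L, forall B, size (f B) = size B} ->
  zip (flatten L) (flatten (map f L)) = flatten [seq zip B (f B) | B <- L].
Proof.
elim: L => //= B L IH H; rewrite zip_cat ?H ?mem_head // IH //.
by move=> B' hB; apply: H; rewrite inE hB orbT.
Qed.

Lemma lnkP L f B C t : {in L, forall B, size (f B) = size B} ->
  uniq (flatten L) -> B \in L -> (C, t) \in zip B (f B) -> t = lnk L f C.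
Proof.
move=> Hsz Hu HB Ht.
have : (C, t) \in zip (flatten L) (flatten (map f L)).
  rewrite zip_flatten_map //; apply/flattenP; exists (zip B (f B)) => //.
  exact: (map_f (fun B => zip B (f B))).
by rewrite (mem_zip_uniq (Node (Vr 0) [::])) ?size_flatten_map // => /andP[_ /eqP].
Qed.

Lemma lnk_ex L f C : {in L, forall B, size (f B) = size B} ->
  C \in flatten L -> exists2 B, B \in L & (C, lnk L f C) \in zip B (f B).
Proof.
move=> Hsz HC.
have : (C, lnk L f C) \in zip (flatten L) (flatten (map f L)).
  have E := size_flatten_map Hsz.
  have hi : index C (flatten L) < size (flatten L) by rewrite index_mem.
  have <- : nth (C, Node (Vr 0) [::]) (zip (flatten L) (flatten (map f L))) (index C (flatten L)) = (C, lnk L f C).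
    by rewrite nth_zip // nth_index.
  by apply: mem_nth; rewrite size_zip E minnn.
rewrite zip_flatten_map // => /flattenP[z /mapP[B HB ->]] H.
by exists B.
Qed.

End Links.

(** * Generated forests are terminal patterns and are the values of derivation trees *)

Section Languages.
Variables (V T : eqType) (rk : T -> nat) (G : transducer V T).
Hypothesis wfG : wf rk G.
Implicit Types (r : rule V T) (t : tree (sym V T)).

Lemma lhs_bigs r : r \in rules G -> lhs r \in bigs G.
Proof. by move=> /(wf_rules wfG)[]. Qed.

Lemma bigs_uniq A : A \in bigs G -> uniq A.
Proof. by move=> /(wf_bigs wfG)[]. Qed.

Lemma bigs_nts A : A \in bigs G -> {subset A <= nts G}.
Proof. by move=> /(wf_bigs wfG)[]. Qed.

Lemma uniq_flatten_links r : r \in rules G -> uniq (flatten (links r)).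
Proof.
move=> /(wf_rules wfG) Hr; apply: uniq_flatten.
- exact: wf_links_uniq Hr.
- by move=> s /(wf_links_bigs Hr)/bigs_uniq.
- exact: wf_links_disj Hr.
Qed.

Lemma occN_links r : r \in rules G -> {subset occN_forest (rhs r) <= flatten (links r)}.
Proof. by move=> /(wf_rules wfG) Hr C; rewrite (wf_links_occ Hr). Qed.

Lemma flatten_links_nts r : r \in rules G -> {subset flatten (links r) <= nts G}.
Proof.
move=> /(wf_rules wfG) Hr C /flattenP[B /(wf_links_bigs Hr)/bigs_nts]; exact.
Qed.

Lemma occN_nts r : r \in rules G -> {subset occN_forest (rhs r) <= nts G}.
Proof. by move=> Hr C /(occN_links Hr)/(flatten_links_nts Hr). Qed.

Lemma rule_pattern r C t : r \in rules G -> (C, t) \in zip (lhs r) (rhs r) ->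
  pattern (nt_rk G) rk (nt_rk G C) t.
Proof. by move=> /(wf_rules wfG) Hr; apply: wf_pat Hr _ _. Qed.

Lemma uniq_occN_rule r C t : r \in rules G -> (C, t) \in zip (lhs r) (rhs r) ->
  uniq (occN t).
Proof.
by move=> /(wf_rules wfG) Hr /mem_zip2; apply: uniq_occN; apply: wf_uniqN Hr.
Qed.

Lemma occN_rule r C t D : (C, t) \in zip (lhs r) (rhs r) -> D \in occN t ->
  D \in occN_forest (rhs r).
Proof. by move=> /mem_zip2 Ht; apply: mem_occN_forest. Qed.

Definition tpatterns (A : seq V) (v : seq (tree (sym V T))) :=
  size v = size A /\
  forall C t, (C, t) \in zip A v -> tpattern (nt_rk G) rk (nt_rk G C) t.

Lemma lnk_tpattern L f C :
  (forall B, B \in L -> tpatterns B (f B)) -> C \in flatten L ->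
  tpattern (nt_rk G) rk (nt_rk G C) (lnk L f C).
Proof.
move=> H HC; have [|B HB] := lnk_ex (f := f) _ HC; first by move=> B /H[].
by case: (H B HB) => _; apply.
Qed.

Lemma tpatterns_rule r f : r \in rules G ->
  (forall B, B \in links r -> tpatterns B (f B)) ->
  tpatterns (lhs r) (map (bsub (lnk (links r) f)) (rhs r)).
Proof.
move=> Hr H; split; first by rewrite size_map (wf_size (wf_rules wfG Hr)).
move=> C t' /mem_zip_mapr[t Ht ->].
apply: tpattern_bsub; last exact: rule_pattern Ht.
move=> D /(occN_rule Ht)/(occN_links Hr); exact: lnk_tpattern.
Qed.

Lemma Lang_tpatterns A v : Lang G A v -> tpatterns A v.
Proof.
elim=> r f Hr HL IH; rewrite subst_linksE; first exact: tpatterns_rule.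
  by move=> B /IH[].
exact: occN_links.
Qed.

(** Turns the list of subderivations into a function on links, so that [der_val] becomes an instance
    of [subst_links]. *)
Definition dval (L : seq (seq V)) (ds : seq (tree (rule V T))) B :=
  nth [::] (map (@der_val V T) ds) (index B L).

Lemma map_dval L ds : uniq L -> size ds = size L ->
  map (dval L ds) L = map (@der_val V T) ds.
Proof.
move=> Hu Hs; apply: (@eq_from_nth _ [::]); rewrite !size_map // => i hi.
by rewrite (nth_map [::]) // /dval index_uniq.
Qed.

Lemma dvalP L ds B : size ds = size L -> B \in L ->
  exists2 d, (B, d) \in zip L ds & dval L ds B = der_val d.
Proof.
case: ds => [|d0 ds] Hs HB; first by rewrite (size0nil (esym Hs)) in HB.
have hi: index B L < size L by rewrite index_mem.
exists (nth d0 (d0 :: ds) (index B L)); last by rewrite /dval (nth_map d0) // Hs.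
have <- : nth ([::], d0) (zip L (d0 :: ds)) (index B L) = (B,
  nth d0 (d0 :: ds) (index B L)).
  by rewrite nth_zip // nth_index.
by apply: mem_nth; rewrite size_zip Hs minnn.
Qed.

Lemma der_val_node r ds : r \in rules G -> size ds = rule_rk r ->
  der_val (Node r ds) = subst_links (links r) (dval (links r) ds) (rhs r).
Proof.
move=> /(wf_rules wfG)/wf_links_uniq Hu Hs.
by rewrite /subst_links map_dval.
Qed.

Lemma Lder_Lang A d : Lder_at G A d -> Lang G A (der_val d).
Proof.
elim=> r ds Hr Hs _ IH; rewrite der_val_node //; apply: Lang_rule => // B HB.
by have [d0 h ->] := dvalP Hs HB; apply: IH.
Qed.

Lemma Lang_Lder A v : Lang G A v -> exists2 d, Lder_at G A d & der_val d = v.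
Proof.
elim=> r f Hr _ IH.
suff [ds [Hs Hd E]]: exists ds, [/\ size ds = size (links r),
    (forall B d, (B, d) \in zip (links r) ds -> Lder_at G B d) &
    map (@der_val V T) ds = map f (links r)].
  exists (Node r ds); first exact: Lder_rule.
  by rewrite /= E.
(* The finitely many derivations are picked one link at a time, so no choice principle is
   involved. *)
elim: (links r) IH => [|B L IHL] IH; first by exists [::].
have [|ds [Hs Hd E]] := IHL; first by move=> B' hB; apply: IH; rewrite inE hB orbT.
have [d h1 h2] := IH B (mem_head _ _).
exists (d :: ds); split=> /=; rewrite ?Hs ?h2 ?E //.
by move=> B' d'; rewrite inE => /orP[/eqP[-> ->]|/Hd].
Qed.

End Languages.

(** * The annotated grammars *)

(** Two renamings, since a nonterminal may occur on both sides of a rule with different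
    annotations. *)
Definition arule V W T (g g' : V -> W) (r : rule V T) : rule W T :=
  (map g (lhs r), map (tree_map (rn g')) (rhs r), map (map g') (links r)).

(** A big nonterminal becomes a single name of the tree grammar; the length prefixes make the
    concatenation decodable. *)
Definition hname (A : seq (seq nat)) : seq nat := flatten [seq size x :: x | x <- A].

Lemma hname_inj : injective hname.
Proof.
elim=> [|x A IH] [|y B] //=; rewrite /hname /= => -[] Es.
by move/eqP; rewrite eqseq_cat // => /andP[/eqP -> /eqP/IH ->].
Qed.

Lemma map_subset (A B : eqType) (f : A -> B) (s s' : seq A) :
  {subset s <= s'} -> {subset map f s <= map f s'}.
Proof. by move=> H y /mapP[x /H hx ->]; apply: map_f. Qed.

Lemma flat_pairs_inj (p q : ann) m k :
  flatten [seq [:: (p i).1; (p i).2] | i <- iota m k] =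
  flatten [seq [:: (q i).1; (q i).2] | i <- iota m k] ->
  forall i, m <= i < m + k -> p i = q i.
Proof.
elim: k m => [|k IH] m /=; first by move=> _ i; rewrite addn0 ltnNge andbN.
case=> e1 e2 /IH {}IH i /andP[]; rewrite leq_eqVlt => /orP[/eqP <- _|h1 h2].
  by rewrite (surjective_pairing (p m)) e1 e2 -surjective_pairing.
by apply: IH; rewrite h1 addSnnS.
Qed.

Section Annotated.
Variables (V T : eqType) (rk : T -> nat) (G : transducer V T).
Hypothesis wfG : wf rk G.
Variables (inN1 : pred V) (Delta : pred T) (w : seq T).
Hypothesis inN1_S1 : inN1 (S1 G).
Hypothesis inN1_S2 : ~~ inN1 (S2 G).
Hypothesis inN1_rule : forall r, r \in rules G ->
  forall C t, (C, t) \in zip (lhs r) (rhs r) -> {in occN t, forall D, inN1 D = inN1 C}.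

Implicit Types (y : ann) (P al : V -> ann) (C D : V).

Notation rkN := (nt_rk G).

(* Only the first component of the transduction is compared with w. *)
Definition letters C : pred T := if inN1 C then Delta else pred0.

(** The names in [V] have no numeric form, so a nonterminal is coded by its position in [nts G].
    [era] decodes it and forgets the annotation. *)
Definition nm y C : seq nat :=
  index C (nts G) :: flatten [seq [:: (y i).1; (y i).2] | i <- iota 0 (rkN C).+1].
Definition nmf P C := nm (P C) C.
Definition era (x : seq nat) : V := nth (S1 G) (nts G) (head 0 x).
Definition rkw x := rkN (era x).

Lemma era_nmf P C : C \in nts G -> era (nmf P C) = C.
Proof. exact: nth_index. Qed.

Lemma map_era_nmf P A : {subset A <= nts G} -> map era (map (nmf P) A) = A.
Proof.
move=> H; rewrite -map_comp -[RHS]map_id; apply/eq_in_map => C /H.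
exact: era_nmf.
Qed.

Lemma map_nmf_eq P P' A A' : {subset A <= nts G} -> {subset A' <= nts G} ->
  map (nmf P) A = map (nmf P') A' -> A = A'.
Proof. by move=> h h' /(congr1 (map era)); rewrite !map_era_nmf. Qed.

Lemma map_era_links P (L : seq (seq V)) : (forall B, B \in L -> {subset B <= nts G}) ->
  map (map era) (map (map (nmf P)) L) = L.
Proof.
move=> H; rewrite -map_comp -[RHS]map_id; apply/eq_in_map => B /H.
exact: map_era_nmf.
Qed.

Lemma rn_era_nmf P (t : tree (sym V T)) : {subset occN t <= nts G} ->
  tree_map (rn era) (tree_map (rn (nmf P)) t) = t.
Proof.
move=> H; rewrite tree_map_comp (@tree_map_ext _ _ _ (rn (era \o nmf P))).
  by apply: tree_map_id_in => C /H; apply: era_nmf.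
by case.
Qed.

(** A name fixes an annotation only up to the rank, which by [reads_ext] is all that matters for a
    run. *)
Lemma nmf_inj P P' C i : nmf P C = nmf P' C -> i <= rkN C -> P C i = P' C i.
Proof.
move=> /(congr1 behead) E hi.
by apply: (flat_pairs_inj (m := 0) (k := (rkN C).+1)); [exact: E | rewrite add0n].
Qed.

Definition valid (r : rule V T) P al := forall C t, (C, t) \in zip (lhs r) (rhs r) ->
  run w (letters C) (P C) al t (P C 0).1 (P C 0).2.

Definition bounded_on (s : seq V) P :=
  {in s, forall C i, i <= rkN C -> bounded (size w) (P C i)}.

Definition reads_all A P (v : seq (tree (sym V T))) :=
  forall C t, (C, t) \in zip A v -> reads w (letters C) (P C) t.

(** The first tree must read all of [w]; the second reads no letter and stays at 0. *)
Definition start_ann C : ann :=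
  if C == S1 G then (fun=> (0, size w)) else (fun=> (0, 0)).
Definition start := map (nmf start_ann) [:: S1 G; S2 G].

(** The correctness proof is independent of how the annotated rules are listed: every listed rule
    must be valid, and every valid rule with bounded positions must be listed. The original rule is
    kept in the pair because it is the terminal symbol in [Hw]. *)
Variable arules : seq (rule V T * rule (seq nat) T).
Hypothesis arules_valid : forall r r', (r, r') \in arules ->
  r \in rules G /\ exists P al, valid r P al /\ r' = arule (nmf P) (nmf al) r.
Hypothesis valid_arules : forall r P al, r \in rules G ->
  bounded_on (lhs r) P -> bounded_on (occN_forest (rhs r)) al -> valid r P al ->
  (r, arule (nmf P) (nmf al) r) \in arules.

Definition abigs := start :: flatten [seq lhs p.2 :: links p.2 | p <- arules].
Definition Gw : transducer (seq nat) T :=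
  Transducer (flatten abigs) rkw abigs (nmf start_ann (S1 G)) (nmf start_ann (S2 G))
    (map snd arules).
Definition Hw : rtg (seq nat) (rule V T) :=
  Rtg (map hname abigs) (hname start)
    [seq (hname (lhs p.2), p.1, map hname (links p.2)) | p <- arules].

Lemma rulesGw r' : r' \in rules Gw -> exists r P al,
  [/\ r \in rules G, valid r P al & r' = arule (nmf P) (nmf al) r].
Proof.
case/mapP=> -[r r2] /= /arules_valid[Hr [P [al [Hv ->]]]] ->.
by exists r, P, al.
Qed.

Lemma abigsP A' : A' \in abigs -> exists A P, A \in bigs G /\ A' = map (nmf P) A.
Proof.
rewrite inE => /orP[/eqP ->|/flattenP[s /mapP[[r r'] Hp ->]]].
  by exists [:: S1 G; S2 G], start_ann; split=> //; apply: wf_S wfG.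
have [Hr [P [al [_ ->]]]] := arules_valid Hp; rewrite inE => /orP[/eqP ->|].
  by exists (lhs r), P; split=> //; exact: (lhs_bigs wfG Hr).
move=> /mapP[B HB ->]; exists B, al; split=> //.
exact: (wf_links_bigs (wf_rules wfG Hr)).
Qed.

Lemma lhs_abigs r r' : (r, r') \in arules -> lhs r' \in abigs.
Proof.
move=> Hp; rewrite inE; apply/orP; right; apply/flattenP.
exists (lhs r' :: links r'); last exact: mem_head.
exact: (map_f (fun p : rule V T * rule (seq nat) T => lhs p.2 :: links p.2) Hp).
Qed.

Lemma links_abigs r r' : (r, r') \in arules -> {subset links r' <= abigs}.
Proof.
move=> Hp B HB; rewrite inE; apply/orP; right; apply/flattenP.
exists (lhs r' :: links r'); last by rewrite inE HB orbT.
exact: (map_f (fun p : rule V T * rule (seq nat) T => lhs p.2 :: links p.2) Hp).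
Qed.

Lemma links_nts r : r \in rules G -> forall B, B \in links r -> {subset B <= nts G}.
Proof. move=> Hr B HB; apply: (bigs_nts wfG).
exact: (wf_links_bigs (wf_rules wfG Hr)). Qed.

Lemma lhs_nts r : r \in rules G -> {subset lhs r <= nts G}.
Proof. by move=> Hr; apply: (bigs_nts wfG); apply: (lhs_bigs wfG Hr). Qed.

(** On [nts G] erasing is a left inverse of annotating, so annotating is injective there and
    preserves uniqueness and disjointness. *)
Lemma wf_annotated_rule r r' : (r, r') \in arules -> wf_rule rk Gw r'.
Proof.
move=> Hp; have [Hr [P [al [_ E]]]] := arules_valid Hp.
have Hw := wf_rules wfG Hr.
have injL : {in links r &, injective (map (nmf al))}.
  by move=> B B' hB hB' /map_nmf_eq; apply; apply: (links_nts Hr).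
have eraN x : x \in occN_forest (rhs r') -> era x \in occN_forest (rhs r).
  rewrite E /rhs /= occN_forest_rn => /mapP[C hC ->].
  by rewrite era_nmf //; exact: (occN_nts wfG Hr).
split.
- exact: lhs_abigs Hp.
- by rewrite E /lhs /rhs /= !size_map (wf_size Hw).
- rewrite E => C' t' /mem_zip_mapr[t1 /mem_zip_mapl[C Ht ->] ->].
  have hC : C \in nts G by apply: (lhs_nts Hr); apply: mem_zip1 Ht.
  rewrite /= /rkw era_nmf // (@pattern_rn _ _ _ (nmf al) rkN); first exact: (wf_pat Hw).
  by move=> D hD; rewrite era_nmf //; apply: (occN_nts wfG Hr); apply: occN_rule Ht hD.
- rewrite E /rhs /= occN_forest_rn map_inj_in_uniq ?(wf_uniqN Hw) //.
  move=> C C' h h' /(congr1 era); rewrite !era_nmf //; exact: (occN_nts wfG Hr).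
- by rewrite E /links /= map_inj_in_uniq ?(wf_links_uniq Hw).
- exact: links_abigs Hp.
- rewrite E => _ _ /mapP[B HB ->] /mapP[B' HB' ->] Hne.
  have {}Hne : B != B' by apply: contraNneq Hne => ->.
  apply: contra (wf_links_disj Hw HB HB' Hne) => /hasP[x /mapP[C HC ->] /mapP[C' HC' EC]].
  apply/hasP; exists C => //=.
  by move/(congr1 era): EC; rewrite !era_nmf => [->|/=|/=] //;
    exact: (links_nts Hr _ HC) || exact: (links_nts Hr _ HC').
- move=> C'; rewrite E /links /rhs /= occN_forest_rn -map_flatten.
  by apply/mapP/mapP => -[C hC ->]; exists C => //;
    rewrite ?(wf_links_occ Hw) // -(wf_links_occ Hw).
- apply: contra (wf_S1 Hw) => /eraN; rewrite era_nmf //.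
  by apply: (bigs_nts wfG (wf_S wfG)); rewrite mem_head.
- apply: contra (wf_S2 Hw) => /eraN; rewrite era_nmf //.
  by apply: (bigs_nts wfG (wf_S wfG)); rewrite !inE eqxx orbT.
Qed.

Lemma S1_nts : S1 G \in nts G.
Proof. by apply: (bigs_nts wfG (wf_S wfG)); rewrite mem_head. Qed.

Lemma S2_nts : S2 G \in nts G.
Proof. by apply: (bigs_nts wfG (wf_S wfG)); rewrite !inE eqxx orbT. Qed.

Lemma wf_Gw : wf rk Gw.
Proof.
split.
- exact: wf_sigma wfG.
- move=> A' HA; have [A [P [HA0 E]]] := abigsP HA; split.
  + by rewrite E; have [] := wf_bigs wfG HA0; case: (A).
  + rewrite E map_inj_in_uniq ?(bigs_uniq wfG) // => C C' h h' /(congr1 era).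
    by rewrite !era_nmf //; apply: (bigs_nts wfG HA0).
  + by move=> x hx; apply/flattenP; exists A'.
- move=> A1 A2 /abigsP[A [P [HA ->]]] /abigsP[A' [P' [HA' ->]]] Hi.
  have nA := bigs_nts wfG HA; have nA' := bigs_nts wfG HA'.
  have Hnm C : C \in A -> exists2 C', C' \in A' & nmf P C = nmf P' C'.
    by move=> hC; apply/mapP; rewrite -Hi map_f.
  (* Erasing turns equal sets of names into equal occurrence sets in [G], where these determine the
     big nonterminal. *)
  have EA : A = A'.
    apply: (wf_occ wfG) => // C; apply/idP/idP => hC.
      have [C' hC' /(congr1 era)] := Hnm C hC.
      by rewrite (era_nmf _ (nA _ hC)) (era_nmf _ (nA' _ hC')) => ->.
    have /mapP[C' hC' /(congr1 era)] : nmf P' C \in map (nmf P) A by rewrite Hi map_f.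
    by rewrite (era_nmf _ (nA' _ hC)) (era_nmf _ (nA _ hC')) => ->.
  rewrite -EA; apply/eq_in_map => C hC; have [C' hC' E] := Hnm C hC.
  by move/(congr1 era): (E); rewrite (era_nmf _ (nA _ hC)) (era_nmf _ (nA' _ hC')) =>
    EC; rewrite EC in E *.
- exact: mem_head.
- by rewrite /= /rkw !era_nmf ?S1_nts ?S2_nts //; apply: wf_S_rk wfG.
- by move=> r' /mapP[[r r2] /wf_annotated_rule] /= H ->.
- move=> r1' r2' /rulesGw[r1 [P1 [al1 [Hr1 _ E1]]]] /rulesGw[r2 [P2 [al2 [Hr2 _ E2]]]] El Er Ek.
  have Er12 : rhs r1 = rhs r2.
    move/(congr1 (map (tree_map (rn era)))): Er; rewrite E1 E2 /rhs /= -!map_comp.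
    have K r al : r \in rules G -> map (tree_map (rn era) \o tree_map (rn (nmf al))) (rhs r) = rhs r.
      move=> Hr; rewrite -[RHS]map_id; apply/eq_in_map => t ht; apply: rn_era_nmf => C hC.
      by apply: (occN_nts wfG Hr); apply: mem_occN_forest hC.
    by rewrite -/(rhs r1) -/(rhs r2) !K.
  have Ek12 B : (B \in links r1) = (B \in links r2).
    have K r al : r \in rules G -> (B \in links r) =
      (B \in map (map era) (links (arule (nmf P1) (nmf al) r))).
      by move=> Hr; rewrite /links /= map_era_links //; apply: links_nts.
    rewrite (K _ al1 Hr1) (K _ al2 Hr2).
    have -> : links (arule (nmf P1) (nmf al2) r2) = links r2' by rewrite E2.
    have -> : links (arule (nmf P1) (nmf al1) r1) = links r1' by rewrite E1.
    by apply/mapP/mapP => -[B' hB ->]; exists B' => //; rewrite ?Ek // -Ek.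
  have El12 : lhs r1 = lhs r2.
    by move: El; rewrite E1 E2 /lhs /= => /map_nmf_eq; apply; apply: lhs_nts.
  have Er' : r1 = r2 by apply: (wf_order wfG).
  (* Both sequences annotate the links of one rule in the same order, and a name determines its
     link; hence equal sets of names give equal sequences. *)
  have Elk : links r1' = links r2'.
    rewrite E1 E2 /links /= -Er'; apply/eq_in_map => B hB.
    have : map (nmf al1) B \in links r2' by rewrite -Ek E1 /links /= map_f.
    rewrite E2 /links /= -Er' => /mapP[B' hB' EB]; rewrite EB.
    by rewrite (map_nmf_eq _ _ EB) //; apply: links_nts Hr1 _ _.
  by move: El Er Elk; case: (r1') => [[? ?] ?]; case: (r2') => [[? ?] ?];
    rewrite /lhs /rhs /links /= => -> -> ->.
- exists (fun x => inN1 (era x)); split; rewrite /= ?era_nmf ?S1_nts ?S2_nts //.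
  move=> r' /rulesGw[r [P [al [Hr _ ->]]]] C' t' /mem_zip_mapr[t1 /mem_zip_mapl[C Ht ->] ->] D'.
  rewrite occN_rn => /mapP[D hD ->].
  rewrite !era_nmf; first exact: inN1_rule Hr _ _ Ht _ hD.
  + by apply: (lhs_nts Hr); apply: mem_zip1 Ht.
  + by apply: (occN_nts wfG Hr); apply: occN_rule Ht hD.
Qed.

Lemma wf_Hw : wf_rtg (rules G) (@rule_rk V T) Hw.
Proof.
split; first exact: mem_head.
move=> A a As /mapP[[r r'] Hp [-> -> ->]].
have [Hr [P [al [_ E]]]] := arules_valid Hp.
split=> //.
- exact: (map_f hname (lhs_abigs Hp)).
- by rewrite E /links /= !size_map.
- by apply: map_subset; apply: links_abigs Hp.
Qed.

(** This is where the partition of the nonterminals enters: a component of a rule compares letters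
    either everywhere or nowhere. *)
Lemma letters_rule (r : rule V T) C t D : r \in rules G ->
  (C, t) \in zip (lhs r) (rhs r) -> D \in occN t -> letters D = letters C.
Proof. by move=> Hr Ht HD; rewrite /letters (inN1_rule Hr Ht HD). Qed.

Lemma occN_nmf_links (r : rule V T) P al : r \in rules G ->
  {subset occN_forest (rhs (arule (nmf P) (nmf al) r)) <=
     flatten (links (arule (nmf P) (nmf al) r))}.
Proof.
move=> Hr; rewrite /rhs /links /= occN_forest_rn -map_flatten.
exact: map_subset (occN_links wfG Hr).
Qed.

(** Soundness, by induction on the generation: the links read as annotated, the rule is valid, and
    [run_bsub] combines both. The statement quantifies over all [P] giving the name [A'], since the
    annotation in the rule agrees with [P] only up to ranks. *)
Lemma Lang_Gw A' v' : Lang Gw A' v' ->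
  forall A P, {subset A <= nts G} -> A' = map (nmf P) A ->
  Lang G A (map (tree_map (rn era)) v') /\
  reads_all A P (map (tree_map (rn era)) v').
Proof.
elim=> r' f' /rulesGw[r [P0 [al [Hr Hv Er']]]] _ IH A P HA EA.
have El : lhs r = A by move: EA; rewrite Er' => /map_nmf_eq; apply => //; apply: lhs_nts.
have EP C : C \in A -> nmf P0 C = nmf P C.
  by move: EA; rewrite Er' /lhs /= -/(lhs r) El => /eq_in_map; apply.
pose f B := map (tree_map (rn era)) (f' (map (nmf al) B)).
have {}IH B : B \in links r -> Lang G B (f B) /\ reads_all B al (f B).
  move=> HB; apply: (IH (map (nmf al) B)) => //; first by rewrite Er' /links /= map_f.
  exact: (links_nts Hr HB).
have Hsz : {in links r, forall B, size (f B) = size B}.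
  by move=> B /IH[/(Lang_tpatterns wfG)[]].
have Hsz' : {in links r', forall B, size (f' B) = size B}.
  by rewrite Er' => _ /mapP[B HB ->]; rewrite size_map -Hsz // size_map.
have Elnk C : C \in flatten (links r) -> lnk (links r) f C =
    tree_map (rn era) (lnk (links r') f' (nmf al C)).
  move=> HC; have [|B' HB' Hz] := lnk_ex (C := nmf al C) Hsz'.
    by rewrite Er' /links /= -map_flatten map_f.
  move: HB'; rewrite {1}Er' => /mapP[B HB EB]; rewrite EB in Hz.
  symmetry; apply: (lnkP Hsz (uniq_flatten_links wfG Hr) HB).
  have := mem_zip_map era (tree_map (rn era)) Hz.
  rewrite map_era_nmf; last exact: (links_nts Hr HB).
  by rewrite era_nmf //; apply: (flatten_links_nts wfG Hr HC).
have Ev : map (tree_map (rn era)) (subst_links (links r') f' (rhs r')) =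
    map (bsub (lnk (links r) f)) (rhs r).
  rewrite subst_linksE //; last by rewrite Er'; apply: occN_nmf_links.
  rewrite [in rhs r']Er' /rhs /= -!map_comp; apply/eq_in_map => t ht /=.
  have Hocc C : C \in occN t -> C \in flatten (links r).
    by move=> hC; apply: (occN_links wfG Hr); apply: mem_occN_forest hC.
  rewrite (@bsub_rn _ _ _ era _ (lnk (links r) f)).
    rewrite rn_era_nmf // => C /Hocc; exact: (flatten_links_nts wfG Hr).
  move=> x; rewrite occN_rn => /mapP[C /Hocc hC ->].
  by rewrite era_nmf ?Elnk //; apply: (flatten_links_nts wfG Hr hC).
rewrite Ev -El; split.
  rewrite -(subst_linksE Hsz (occN_links wfG Hr)); apply: Lang_rule => // B HB.
  by case: (IH B HB).
move=> C t' /mem_zip_mapr[t Ht ->].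
have hC : C \in A by rewrite -El; apply: mem_zip1 Ht.
have Hp := rule_pattern wfG Hr Ht.
have HU D : D \in occN t -> tpattern rkN rk (rkN D) (lnk (links r) f D) /\
    reads w (letters C) (al D) (lnk (links r) f D).
  move=> hD; have hD' : D \in flatten (links r).
    by apply: (occN_links wfG Hr); apply: occN_rule Ht hD.
  split; first by apply: (lnk_tpattern _ hD') => B /IH[/(Lang_tpatterns wfG)].
  rewrite -(letters_rule Hr Ht hD).
  by have [B HB Hz] := lnk_ex Hsz hD'; have [_ H] := IH B HB; apply: H Hz.
apply: (reads_ext (rkN := rkN) (rk := rk) (k := rkN C) (y := P0 C)).
- by apply: tpattern_bsub => // D /HU[].
- by move=> i; apply: nmf_inj; apply: EP.
- by apply: run_bsub HU _; [case/andP: Hp | apply: Hv].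
Qed.

(** A derivation in [Hw] carries both the original rules and, in its nonterminals, the annotated
    ones. The constant renaming only changes the type of the names: values contain no
    nonterminals. *)
Lemma rtg_gen_Gw X d : rtg_gen Hw X d -> forall A', X = hname A' ->
  Lder_at G (map era A') d /\
  Lang Gw A' (map (tree_map (rn (fun=> [::]))) (der_val d)).
Proof.
elim=> _ _ _ ds /mapP[[r r'] Hp [-> -> ->]] /= Hs _ IH A' /hname_inj <-.
have [Hr [P [al [_ Er']]]] := arules_valid Hp.
have Elk : links r' = map (map (nmf al)) (links r) by rewrite Er'.
have Hs' : size ds = size (links r) by rewrite Hs Elk !size_map.
have {}IH B d1 : (B, d1) \in zip (links r) ds -> Lder_at G B d1 /\
    Lang Gw (map (nmf al) B) (map (tree_map (rn (fun=> [::]))) (der_val d1)).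
  move=> Hz; have HB := mem_zip1 Hz.
  have := IH (hname (map (nmf al) B)) d1 _ (map (nmf al) B) erefl.
  rewrite map_era_nmf; last exact: (links_nts Hr HB).
  apply; rewrite Elk -map_comp; have := mem_zip_map (hname \o map (nmf al)) id Hz.
  by rewrite map_id.
have Hder : Lder_at G (lhs r) (Node r ds).
  by apply: Lder_rule => // B d1 /IH[].
split.
  by rewrite Er' /lhs /= map_era_nmf //; apply: lhs_nts.
pose f := dval (links r) ds.
(* The value for an annotated link is found through the erased link. *)
pose f' B' := map (tree_map (rn (fun=> [::]))) (f (map era B')) : seq (tree (sym (seq nat) T)).
have EB B : B \in links r -> map era (map (nmf al) B) = B.
  by move=> HB; rewrite map_era_nmf //; apply: (links_nts Hr HB).
have Hf B : B \in links r -> Lang G B (f B) /\ Lang Gw (map (nmf al) B) (f' (map (nmf al) B)).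
  move=> HB; rewrite /f' EB // /f; have [d1 Hz ->] := dvalP Hs' HB.
  by case: (IH B d1 Hz) => h1 h2; split=> //; apply: (Lder_Lang wfG h1).
have Htp B : B \in links r -> tpatterns rk G B (f B).
  by move=> /Hf[/(Lang_tpatterns wfG)].
have Hsz : {in links r, forall B, size (f B) = size B} by move=> B /Htp[].
have Hsz' : {in links r', forall B, size (f' B) = size B}.
  by rewrite Elk => _ /mapP[B HB ->]; rewrite /f' size_map EB // Hsz // size_map.
have Hu' : uniq (flatten (links r')).
  by have := uniq_flatten_links wf_Gw (map_f snd Hp).
have -> : map (tree_map (rn (fun=> [::]))) (der_val (Node r ds)) =
  subst_links (links r') f' (rhs r').
  rewrite (der_val_node wfG) // subst_linksE //; last exact: (occN_links wfG Hr).
  rewrite subst_linksE //; last by rewrite Er'; apply: occN_nmf_links.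
  rewrite [in rhs r']Er' /rhs /= -!map_comp; apply/eq_in_map => t ht /=.
  have Hocc C : C \in occN t -> C \in flatten (links r).
    by move=> hC; apply: (occN_links wfG Hr); apply: mem_occN_forest hC.
  have E0 : occN (bsub (lnk (links r) f) t) = [::].
    by apply: occN_bsub => C /Hocc hC; have [] := lnk_tpattern Htp hC.
  (* As the value has no nonterminals, the dummy renaming may be exchanged for the one that commutes
     with the substitution. *)
  rewrite (@eq_in_rn _ _ _ _ (nmf al)); last by rewrite E0.
  apply: bsub_rn => C /Hocc hC.
  have [B HB Hz] := lnk_ex Hsz hC.
  symmetry; apply: (lnkP Hsz' Hu' (B := map (nmf al) B)); first by rewrite Elk map_f.
  have := mem_zip_map (nmf al) (tree_map (rn (nmf al))) Hz.
  suff -> : map (tree_map (rn (nmf al))) (f B) = f' (map (nmf al) B) by [].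
  rewrite /f' EB //; apply/eq_in_map => t0 ht0; apply: eq_in_rn.
  have [Hsz0 H0] := Htp B HB.
  have [i hi <-] := nthP (Node (Vr 0) [::]) ht0.
  have hz : (nth (S1 G) B i, nth (Node (Vr 0) [::]) (f B) i) \in zip B (f B).
    by rewrite -nth_zip //; apply: mem_nth; rewrite size_zip Hsz0 minnn -Hsz0.
  by have [_ ->] := H0 _ _ hz.
apply: Lang_rule; first exact: (map_f snd Hp).
by rewrite Elk => _ /mapP[B HB ->]; have [] := Hf B HB.
Qed.

(** Glues annotations found for the components of a right-hand side separately; they concern
    disjoint sets of nonterminals. *)
Lemma split_annotation (p : seq (V * tree (sym V T)))
    (Q : V -> tree (sym V T) -> (V -> ann) -> Prop) (R : V -> ann -> Prop) :
  (forall C t al al', {in occN t, forall D, al D = al' D} -> (C, t) \in p ->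
    Q C t al -> Q C t al') ->
  (forall C t, (C, t) \in p -> exists2 al, Q C t al & {in occN t, forall D, R D (al D)}) ->
  uniq (flatten (map (fun q => occN q.2) p)) ->
  exists2 al, (forall C t, (C, t) \in p -> Q C t al) &
     {in flatten (map (fun q => occN q.2) p), forall D, R D (al D)}.
Proof.
elim: p => [|[C t] p IH] Hext H /=; first by exists (@noal V).
rewrite cat_uniq => /and3P[_ /hasPn Hd Hu].
have [a1 h1 h1'] := H C t (mem_head _ _).
have [||//|a2 h2 h2'] := IH.
- by move=> C0 t0 al al' E h; apply: Hext => //; rewrite inE h orbT.
- by move=> C0 t0 h; apply: H; rewrite inE h orbT.
pose al D := if D \in occN t then a1 D else a2 D.
have E2 D : D \in flatten (map (fun q => occN q.2) p) -> al D = a2 D.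
  by move=> hD; rewrite /al (negbTE (Hd D hD)).
exists al.
  move=> C0 t0; rewrite inE => /orP[/eqP[-> ->]|h].
    by apply: Hext h1; [move=> D hD; rewrite /al hD|exact: mem_head].
  apply: Hext (h2 _ _ h); last by rewrite inE h orbT.
  move=> D hD; rewrite E2 //; apply/flattenP; exists (occN t0) => //.
  exact: (map_f (fun q : V * tree (sym V T) => occN q.2) h).
move=> D; rewrite mem_cat => /orP[hD|hD]; first by rewrite /al hD; apply: h1'.
by rewrite E2 //; apply: h2'.
Qed.

(** Completeness, by induction on the derivation: [run_unbsub] recovers the annotations of the links
    from the run of the value, and the resulting valid bounded rule is listed by hypothesis. *)
Lemma Lder_rtg_gen A d : Lder_at G A d -> forall P, bounded_on A P ->
  reads_all A P (der_val d) -> rtg_gen Hw (hname (map (nmf P) A)) d.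
Proof.
elim=> r ds Hr Hs Hd IH P HP; rewrite (der_val_node wfG) //.
set f := dval (links r) ds => Hre.
have Htp B : B \in links r -> tpatterns rk G B (f B).
  move=> HB; rewrite /f; have [d0 Hz ->] := dvalP Hs HB.
  by apply: (Lang_tpatterns wfG); apply: (Lder_Lang wfG); apply: Hd.
have Hsz : {in links r, forall B, size (f B) = size B} by move=> B /Htp[].
have HL := occN_links wfG Hr.
have Hwr := wf_rules wfG Hr.
have Eocc : flatten (map (fun q => occN q.2) (zip (lhs r) (rhs r))) = occN_forest (rhs r).
  rewrite (map_comp (@occN V T) snd) -/unzip2 unzip2_zip //.
  by rewrite (wf_size Hwr).
have [|||al Hrun Hal] := @split_annotation (zip (lhs r) (rhs r))
    (fun C t al => run w (letters C) (P C) al t (P C 0).1 (P C 0).2)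
    (fun D y => (forall i, i <= rkN D -> bounded (size w) (y i)) /\
        reads w (letters D) y (lnk (links r) f D)).
- move=> C t al al' E Ht; have /andP[Hrk _] := rule_pattern wfG Hr Ht.
  by apply: run_ext Hrk _ _ => // D hD i _; rewrite E.
- move=> C t Ht; have /andP[Hrk Hv] := rule_pattern wfG Hr Ht.
  have hC := mem_zip1 Ht.
  have [||||_ [al h1 h2]] := run_unbsub (w := w) (D := letters C) (x := P C) (U :=
    lnk (links r) f)
     (s := (P C 0).1) (e := (P C 0).2) Hrk (uniq_occN_rule wfG Hr Ht).
  + by move=> D hD; apply: (lnk_tpattern Htp); apply: HL; apply: occN_rule Ht hD.
  + by move=> j; rewrite (perm_mem Hv) mem_iota => hj; apply: HP.
  + by have /andP[] := HP C hC 0 isT.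
  + apply: Hre; rewrite subst_linksE //.
    by have := mem_zip_map id (bsub (lnk (links r) f)) Ht; rewrite map_id.
  exists al => // D hD; have [h3 h4] := h2 D hD; split=> //.
  by rewrite (letters_rule Hr Ht hD).
- by rewrite Eocc (wf_uniqN Hwr).
rewrite Eocc in Hal.
have Hp : (r, arule (nmf P) (nmf al) r) \in arules.
  by apply: valid_arules => // D hD; have [] := Hal D hD.
apply: (@Rtg_rule _ _ _ _ _ (map hname (map (map (nmf al)) (links r)))).
- exact: (map_f (fun p : rule V T * rule (seq nat) T => (hname (lhs p.2), p.1,
    map hname (links p.2))) Hp).
- by rewrite Hs !size_map.
move=> X d0; rewrite -map_comp => /mem_zip_mapl[B Hz ->].
have HB := mem_zip1 Hz.
have HD D : D \in B -> D \in occN_forest (rhs r).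
  by move=> hD; rewrite -(wf_links_occ Hwr); apply/flattenP; exists B.
have Ed : f B = der_val d0.
  move: Hz; rewrite (mem_zip_uniq d0) ?(wf_links_uniq Hwr) // => /andP[_ /eqP ->].
  by rewrite /f /dval (nth_map d0) // Hs index_mem.
apply: IH Hz _ _ _; first by move=> D /HD/Hal[].
rewrite -Ed => D t Ht; rewrite (lnkP Hsz (uniq_flatten_links wfG Hr) HB Ht).
by have [] := Hal D (HD D (mem_zip1 Ht)).
Qed.

Lemma bounded_start : bounded_on [:: S1 G; S2 G] start_ann.
Proof.
by move=> C _ i _; rewrite /start_ann /bounded; case: eqP => _ /=; rewrite ?leqnn.
Qed.

(** The yield of [t1] is a prefix of [w] of length |w|, hence equal to [w]; the second tree is read
    with no letters. *)
Lemma reads_start t1 t2 : reads_all [:: S1 G; S2 G] start_ann [:: emb V t1; emb V t2] <->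
  [seq a <- preorder t1 | Delta a] = w.
Proof.
have S12 : (S2 G == S1 G) = false.
  by apply/eqP => E; move: inN1_S2; rewrite E inN1_S1.
have R1 : reads w (letters (S1 G)) (start_ann (S1 G)) (emb V t1) <->
    [seq a <- preorder t1 | Delta a] = w.
  rewrite /reads /letters inN1_S1 /start_ann eqxx /=.
  split=> [/run_emb[]|E]; last by apply/run_emb; rewrite E drop0 prefix_refl.
  rewrite drop0 add0n => E /prefixP[u Eu]; move: E; rewrite {1}Eu size_cat => /eqP;
    rewrite -{2}[size _]addn0 eqn_add2l.
  by move=> /eqP/size0nil Eu0; rewrite Eu Eu0 cats0.
have R2 : reads w (letters (S2 G)) (start_ann (S2 G)) (emb V t2).
  rewrite /reads /letters (negbTE inN1_S2) /start_ann S12 /=.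
  by apply/run_emb; rewrite (eq_filter (a2 := pred0)) // filter_pred0 prefix0s.
split=> [H|/R1 H C t]; first by apply/R1; apply: H; rewrite mem_head.
by rewrite !inE => /orP[/eqP[-> ->]|/eqP[-> ->]].
Qed.

Lemma start_nts : {subset [:: S1 G; S2 G] <= nts G}.
Proof. exact: (bigs_nts wfG (wf_S wfG)). Qed.

Lemma tau_Gw_sound t1 t2 : tau Gw t1 t2 ->
  tau G t1 t2 /\ [seq a <- preorder t1 | Delta a] = w.
Proof.
move=> H; have [] := @Lang_Gw start _ H _ start_ann start_nts erefl.
by rewrite /= !rn_emb => h1 /reads_start h2.
Qed.

Lemma Lder_start d t1 t2 : Lder G d -> der_val d = [:: emb V t1; emb V t2] ->
  [seq a <- preorder t1 | Delta a] = w -> rtg_lang Hw d.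
Proof.
move=> Hd Ed Hw1; apply: (Lder_rtg_gen Hd bounded_start).
by rewrite Ed; apply/reads_start.
Qed.

Lemma rtg_lang_Hw d : rtg_lang Hw d -> Lder G d /\
  exists t1 t2, der_val d = [:: emb V t1; emb V t2] /\ tau Gw t1 t2.
Proof.
move=> /rtg_gen_Gw/(_ start erefl); rewrite map_era_nmf; last exact: start_nts.
case=> Hd HG; split=> //.
have [Hsz Hp] := Lang_tpatterns wfG (Lder_Lang wfG Hd).
case E: (der_val d) Hsz Hp HG => [|v1 [|v2 []]] // _ Hp HG.
have [rk1 rk2] := wf_S_rk wfG.
have [t1 E1] : exists t1, v1 = emb V t1.
  have := Hp (S1 G) v1; rewrite mem_head rk1 => /(_ isT); exact: emb_of_tpattern.
have [t2 E2] : exists t2, v2 = emb V t2.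
  have := Hp (S2 G) v2; rewrite !inE eqxx orbT rk2 => /(_ isT); exact: emb_of_tpattern.
exists t1, t2; rewrite E1 E2; split=> //.
by move: HG; rewrite E1 E2 /= !rn_emb.
Qed.

(** From right to left the proof passes through [Hw]: a derivation of the pair in [G] is generated
    by [Hw], which puts its value into the new transducer. *)
Lemma tau_GwP t1 t2 :
  tau Gw t1 t2 <-> tau G t1 t2 /\ [seq a <- preorder t1 | Delta a] = w.
Proof.
split; first exact: tau_Gw_sound.
case=> /(Lang_Lder)[d Hd Ed] /(Lder_start Hd Ed)/rtg_lang_Hw[_ [u1 [u2 []]]].
by rewrite Ed => -[/emb_inj -> /emb_inj ->].
Qed.

Lemma rtg_lang_HwP d : rtg_lang Hw d <-> Lder G d /\
  exists t1 t2, der_val d = [:: emb V t1; emb V t2] /\ tau Gw t1 t2.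
Proof.
split; first exact: rtg_lang_Hw.
by case=> Hd [t1 [t2 [Ed /tau_Gw_sound[_ Ew]]]]; exact: (Lder_start Hd Ed Ew).
Qed.

End Annotated.

(** * Symbolic traversal of a right-hand side *)

(* A symbolic position: a free position (an index into an environment), or 0, *)
(* plus a constant.                                                           *)
Definition pexp := (option nat * nat)%type.
Definition ev (rho : seq nat) (p : pexp) : nat := oapp (nth 0 rho) 0 p.1 + p.2.
Definition ev2 rho (p : pexp * pexp) := (ev rho p.1, ev rho p.2).
Definition pvar v : pexp := (Some v, 0).
Definition psucc (p : pexp) : pexp := (p.1, p.2.+1).
Definition sann := nat -> pexp * pexp.

Lemma ev_var rho v : ev rho (pvar v) = nth 0 rho v.
Proof. exact: addn0. Qed.

Lemma ev_succ rho p : ev rho (psucc p) = (ev rho p).+1.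
Proof. exact: addnS. Qed.

Definition holds (T : eqType) (w : seq T) rho (cs : seq (pexp * T)) :=
  all (fun c => onth w (ev rho c.1) == Some c.2) cs.

Section Walk.
Variables (V T : eqType) (rkN : V -> nat) (rk : T -> nat) (fe : V -> pexp) (fb : V ->
  nat -> pexp).
Notation rkd := (ranked (sym_rk rkN rk)).
Implicit Types (t : tree (sym V T)) (al : V -> ann) (sal : V -> sann).

(* The end and the positions before the variables are the free positions of a *)
(* nonterminal in a right-hand side, the others depend on them.               *)
Definition free_al rho C (y : ann) :=
  (y 0).2 = ev rho (fe C) /\ forall j, j < rkN C -> (y j.+1).1 = ev rho (fb C j).
Definition sfree_al C (y : sann) :=
  (y 0).2 = fe C /\ forall j, j < rkN C -> (y j.+1).1 = fb C j.

Definition agree rho C (y : ann) (sy : sann) :=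
  forall i, i <= rkN C -> y i = ev2 rho (sy i).

Section Component.
Variables (D : pred T) (fa : nat -> pexp).

(** Result of a symbolic traversal from [s]: for all inputs and environments that match the free
    positions, a run exists exactly if the letter conditions [cs] hold, it ends at [o], and the
    dependent positions are those in [sal] and [sb]. The parameter [R] covers both single trees and
    sequences. *)
Definition walks (occ : seq V) (vs : seq nat) (R : seq T -> ann -> (V -> ann) ->
  nat -> nat -> Prop)
    (s o : pexp) cs sal (sb : nat -> pexp) :=
  {in occ, forall C, sfree_al C (sal C)} /\
  forall w rho x al e,
    {in occ, forall C, free_al rho C (al C)} ->
    {in vs, forall j, (x j.+1).2 = ev rho (fa j)} ->
    (R w x al (ev rho s) e <->
     [/\ holds w rho cs, e = ev rho o,
         {in occ, forall C, agree rho C (al C) (sal C)} &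
         {in vs, forall j, (x j.+1).1 = ev rho (sb j)}]).

Definition merge_in (A : eqType) B (s : seq A) (f g : A -> B) a :=
  if a \in s then f a else g a.

Lemma merge_inl (A : eqType) B (s : seq A) (f g : A -> B) a :
  a \in s -> merge_in s f g a = f a.
Proof. by rewrite /merge_in => ->. Qed.

Lemma merge_inr (A : eqType) B (s s' : seq A) (f g : A -> B) a :
  ~~ has (mem s) s' -> a \in s' -> merge_in s f g a = g a.
Proof. by move=> /hasPn H /H ha; rewrite /merge_in (negbTE (ha : a \notin s)). Qed.

Lemma in_cat (A : eqType) (P : A -> Prop) s s' :
  {in s ++ s', forall a, P a} <-> {in s, forall a, P a} /\ {in s', forall a, P a}.
Proof.
split=> [H|[H1 H2] a]; first by split=> a ha; apply: H; rewrite mem_cat ha ?orbT.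
by rewrite mem_cat => /orP[/H1|/H2].
Qed.

(** The symbolic exit [o1] of the first part is the entry of the second. *)
Lemma walks_seq occ1 vs1 R1 s o1 cs1 sal1 sb1 occ2 vs2 R2 o2 cs2 sal2 sb2 :
  ~~ has (mem occ1) occ2 -> ~~ has (mem vs1) vs2 ->
  walks occ1 vs1 R1 s o1 cs1 sal1 sb1 -> walks occ2 vs2 R2 o1 o2 cs2 sal2 sb2 ->
  walks (occ1 ++ occ2) (vs1 ++ vs2)
    (fun w x al s e => exists2 m, R1 w x al s m & R2 w x al m e) s o2
    (cs1 ++ cs2) (merge_in occ1 sal1 sal2) (merge_in vs1 sb1 sb2).
Proof.
move=> Ho Hv [F1 W1] [F2 W2]; split.
  apply/in_cat; split=> C hC; first by rewrite merge_inl //; apply: F1.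
  by rewrite (merge_inr _ _ Ho) //; apply: F2.
move=> w rho x al e /in_cat[A1 A2] /in_cat[X1 X2]; split.
  case=> m /(W1 _ _ _ _ _ A1 X1)[h1 -> h2 h3] /(W2 _ _ _ _ _ A2 X2)[h4 -> h5 h6].
  split=> //; first by rewrite /holds all_cat [all _ _]h1 [all _ _]h4.
    apply/in_cat; split=> C hC; first by rewrite merge_inl //; apply: h2.
    by rewrite (merge_inr _ _ Ho) //; apply: h5.
  apply/in_cat; split=> C hC; first by rewrite merge_inl //; apply: h3.
  by rewrite (merge_inr _ _ Hv) //; apply: h6.
rewrite /holds all_cat => -[/andP[h1 h4] -> /in_cat[h2 h5] /in_cat[h3 h6]].
exists (ev rho o1).
  apply/W1 => //; split=> // C hC; first by have := h2 C hC; rewrite merge_inl.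
  by have := h3 C hC; rewrite merge_inl.
apply/W2 => //; split=> // C hC; first by have := h5 C hC; rewrite (merge_inr _ _ Ho).
by have := h6 C hC; rewrite (merge_inr _ _ Hv).
Qed.

Definition walkable t := rkd t -> uniq (occN t) -> uniq (vars t) ->
  forall s, exists o cs sal sb,
    walks (occN t) (vars t) (fun w x al => run w D x al t) s o cs sal sb.

Lemma walk_thread ts : allProp walkable ts -> all rkd ts -> uniq (occN_forest ts) ->
  uniq (flatten (map (@vars V T) ts)) ->
  forall s, exists o cs sal sb,
    walks (occN_forest ts) (flatten (map (@vars V T) ts))
      (fun w x al => thread (run w D x al) ts) s o cs sal sb.
Proof.
elim: ts => [|t ts IH] /=.
  move=> _ _ _ _ s; exists s, [::], (fun _ _ => (s, s)), (fun=> s);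
    split=> // w rho x al e _ _.
  by split=> [<-|[]].
rewrite occN_forest_cons !cat_uniq => -[Ht Hts] /andP[r1 r2] /and3P[o1 o2 o3] /and3P[v1 v2 v3] s.
have [m [cs1 [sal1 [sb1 W1]]]] := Ht r1 o1 v1 s.
have [o [cs2 [sal2 [sb2 W2]]]] := IH Hts r2 o3 v3 m.
exists o, (cs1 ++ cs2), (merge_in (occN t) sal1 sal2), (merge_in (vars t) sb1 sb2).
exact: walks_seq o2 v2 W1 W2.
Qed.

(** Each subtree starts at a position known in advance, and its exit, recorded in [so], becomes the
    position after the corresponding variable. *)
Lemma walk_fan ts (b : nat -> pexp) : allProp walkable ts -> all rkd ts ->
  uniq (occN_forest ts) ->
  uniq (flatten (map (@vars V T) ts)) ->
  forall i, exists (so : nat -> pexp) cs sal sb,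
   {in occN_forest ts, forall C, sfree_al C (sal C)} /\
   forall w rho x al y,
    {in occN_forest ts, forall C, free_al rho C (al C)} ->
    {in flatten (map (@vars V T) ts), forall j, (x j.+1).2 = ev rho (fa j)} ->
    (forall j, j < size ts -> (y (i + j)).1 = ev rho (b (i + j))) ->
    (fan (run w D x al) y ts i <->
     [/\ holds w rho cs, forall j, j < size ts -> (y (i + j)).2 = ev rho (so (i + j)),
         {in occN_forest ts, forall C, agree rho C (al C) (sal C)} &
         {in flatten (map (@vars V T) ts), forall j, (x j.+1).1 = ev rho (sb j)}]).
Proof.
elim: ts => [|t ts IH] /=.
  move=> _ _ _ _ i; exists b, [::], (fun _ _ => (b 0, b 0)), b; split=> //.
rewrite occN_forest_cons !cat_uniq => -[Ht Hts] /andP[r1 r2] /and3P[o1 o2 o3] /and3P[v1 v2 v3] i.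
have [o [cs1 [sal1 [sb1 [F1 W1]]]]] := Ht r1 o1 v1 (b i).
have [so [cs2 [sal2 [sb2 [F2 W2]]]]] := IH Hts r2 o3 v3 i.+1.
exists (fun k => if k == i then o else so k), (cs1 ++ cs2),
  (merge_in (occN t) sal1 sal2), (merge_in (vars t) sb1 sb2).
split.
  apply/in_cat; split=> C hC; first by rewrite merge_inl //; apply: F1.
  by rewrite (merge_inr _ _ o2) //; apply: F2.
move=> w rho x al y /in_cat[A1 A2] /in_cat[X1 X2] Hy.
have Hy0 : (y i).1 = ev rho (b i) by have := Hy 0 isT; rewrite addn0.
have Hyj j : j < size ts -> (y (i.+1 + j)).1 = ev rho (b (i.+1 + j)).
  by move=> hj; rewrite addSnnS; apply: Hy.
rewrite Hy0; split.
  case=> /(W1 _ _ _ _ _ A1 X1)[h1 e1 h2 h3] /(W2 _ _ _ _ _ A2 X2 Hyj)[h4 e2 h5 h6].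
  split=> //; first by rewrite /holds all_cat [all _ _]h1 [all _ _]h4.
  - case=> [|j] hj; first by rewrite addn0 eqxx.
    by rewrite -addSnnS gtn_eqF ?e2 // addSn ltnS leq_addr.
  - apply/in_cat; split=> C hC; first by rewrite merge_inl //; apply: h2.
    by rewrite (merge_inr _ _ o2) //; apply: h5.
  - apply/in_cat; split=> C hC; first by rewrite merge_inl //; apply: h3.
    by rewrite (merge_inr _ _ v2) //; apply: h6.
rewrite /holds all_cat => -[/andP[h1 h4] he /in_cat[h2 h5] /in_cat[h3 h6]].
split.
  apply/(W1 _ _ _ _ _ A1 X1); split=> //.
  - by have := he 0 isT; rewrite addn0 eqxx.
  - by move=> C hC; have := h2 C hC; rewrite merge_inl.
  - by move=> C hC; have := h3 C hC; rewrite merge_inl.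
apply/(W2 _ _ _ _ _ A2 X2 Hyj); split=> //.
- move=> j hj; have := he j.+1 hj; rewrite -addSnnS gtn_eqF // addSn ltnS leq_addr //.
- by move=> C hC; have := h5 C hC; rewrite (merge_inr _ _ o2).
- by move=> C hC; have := h6 C hC; rewrite (merge_inr _ _ v2).
Qed.

Lemma walk_tree t : walkable t.
Proof.
elim/tree_ind_all: t => c ts IH Hr.
rewrite occN_node vars_node !cat_uniq => /and3P[_ Hd Ho] /and3P[_ _ Hv] s.
have /andP[/eqP Hsz Hrs] : (size ts == sym_rk rkN rk c) && all rkd ts := Hr.
case: c Hr Hsz Hd => [C|a|j] Hr Hsz Hd.
- have [so [cs [sal [sb [F W]]]]] := walk_fan (fun i => fb C i.-1) IH Hrs Ho Hv 1.
  (* The current position enters the nonterminal and the traversal resumes at its free end; each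
     subtree resumes at the free position before its variable. *)
  pose sC i := if i is j.+1 then (fb C j, so i) else (s, fe C).
  exists (fe C), cs, (merge_in [:: C] (fun=> sC) sal), sb; split.
    apply/in_cat; split=> C' hC'.
      by rewrite merge_inl //; move: hC'; rewrite inE => /eqP ->.
    by rewrite (merge_inr _ _ Hd) //; apply: F.
  move=> w rho x al e /in_cat[A1 A2] X.
  have [AC0 ACj] := A1 C (mem_head _ _).
  have Hy j : j < size ts -> (al C (1 + j)).1 = ev rho (fb C (1 + j).-1).
    by rewrite Hsz => hj; apply: ACj.
  have {}W := W w rho x al (al C) A2 X Hy.
  split.
    case=> E0 /W[h1 h2 h3 h4]; split=> //.
      by rewrite -AC0 -E0.
    apply/in_cat; split=> C' hC'.
      rewrite merge_inl //; move: hC'; rewrite inE => /eqP -> [_|j hj].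
        by rewrite -E0 /ev2 /= -AC0 -E0.
      by rewrite [LHS]surjective_pairing ACj // h2 // Hsz.
    by rewrite (merge_inr _ _ Hd) //; apply: h3.
  case=> h1 -> /in_cat[h2 h3] h4.
  have {}h2 := h2 C (mem_head _ _); rewrite merge_inl ?mem_head // in h2.
  split; first by rewrite h2.
  apply/W; split=> //.
    by move=> j hj; rewrite h2 //; move: hj; rewrite Hsz.
  by move=> C' hC'; have := h3 C' hC'; rewrite (merge_inr _ _ Hd).
- rewrite /=; case: (D a).
    have [o [cs [sal [sb [F W]]]]] := walk_thread IH Hrs Ho Hv (psucc s).
    (* A letter adds one comparison and advances the constant part of the position. *)
    exists o, ((s, a) :: cs), sal, sb; split=> // w rho x al e A X.
    have {}W := W w rho x al e A X; rewrite ev_succ in W; split.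
      by case=> /= h1 /W[h2 h3 h4 h5]; split=> //=; rewrite h1 eqxx.
    by case=> /= /andP[/eqP h1 h2] h3 h4 h5; split=> //; apply/W.
  have [o [cs [sal [sb [F W]]]]] := walk_thread IH Hrs Ho Hv s.
  by exists o, cs, sal, sb; split=> // w rho x al e A X; rewrite ED; apply: W.
- rewrite (size0nil Hsz) /=.
  (* The current position is the one before the variable; the traversal resumes at the free position
     after it. *)
  exists (fa j), [::], (fun _ _ => (s, s)), (fun=> s); split=> // w rho x al e _ X.
  have X0 := X j (mem_head _ _); split=> /=.
    by move=> E; split=> //; [rewrite -X0 -E|move=> i; rewrite inE => /eqP ->; rewrite -E].
  case=> _ -> _ /(_ j (mem_head _ _)) E.
  by rewrite -X0 -E -surjective_pairing.
Qed.

End Component.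

Variables (Df : V -> pred T) (fs : V -> pexp) (fa : V -> nat -> pexp).

(* On a left-hand side, the start and the positions after the variables are   *)
(* free.                                                                      *)
Definition free_lhs rho C (y : ann) :=
  (y 0).1 = ev rho (fs C) /\ forall j, j < rkN C -> (y j.+1).2 = ev rho (fa C j).
Definition sfree_lhs C (y : sann) :=
  (y 0).1 = fs C /\ forall j, j < rkN C -> (y j.+1).2 = fa C j.

(** Each component starts at its own free position, so the components are traversed independently
    and their conditions conjoined. *)
Lemma walk_rule (p : seq (V * tree (sym V T))) : uniq (unzip1 p) ->
  (forall C t, (C, t) \in p -> pattern rkN rk (rkN C) t) ->
  uniq (occN_forest (unzip2 p)) ->
  exists cs (sP sal : V -> sann),
   [/\ {in unzip1 p, forall C, sfree_lhs C (sP C)},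
       {in occN_forest (unzip2 p), forall C, sfree_al C (sal C)} &
     forall w rho P al,
       {in unzip1 p, forall C, free_lhs rho C (P C)} ->
       {in occN_forest (unzip2 p), forall C, free_al rho C (al C)} ->
       ((forall C t, (C, t) \in p -> run w (Df C) (P C) al t (P C 0).1 (P C 0).2) <->
        [/\ holds w rho cs, {in unzip1 p, forall C, agree rho C (P C) (sP C)} &
            {in occN_forest (unzip2 p), forall C, agree rho C (al C) (sal C)}])].
Proof.
elim: p => [|[C t] p IH] /=.
  move=> _ _ _; exists [::], (fun C _ => (fs C, fs C)), (fun C _ => (fs C, fs C)).
  by split=> // w rho P al _ _; split.
rewrite occN_forest_cons cat_uniq => /andP[hC hp] Hpat /and3P[o1 o2 o3].
have [|//|cs2 [sP2 [sal2 [F2 F2' W2]]]] := IH hp.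
  by move=> C' t' h; apply: Hpat; rewrite inE h orbT.
have /andP[Hr Hv] := Hpat C t (mem_head _ _).
have uv : uniq (vars t) by rewrite (perm_uniq Hv) iota_uniq.
have [o [cs1 [sal1 [sb [F1 W1]]]]] := walk_tree (Df C) (fa C) Hr o1 uv (fs C).
have Hvars j : (j \in vars t) = (j < rkN C) by rewrite (perm_mem Hv) mem_iota.
pose sC i := if i is j.+1 then (sb j, fa C j) else (fs C, o).
have hC' : ~~ has (mem [:: C]) (unzip1 p).
  by apply: contra hC => /hasP[C' h]; rewrite /= inE => /eqP <-.
exists (cs1 ++ cs2), (merge_in [:: C] (fun=> sC) sP2), (merge_in (occN t) sal1 sal2).
rewrite -(cat1s C (unzip1 p)); split.
- apply/in_cat; split=> C' h.
    by rewrite merge_inl //; move: h; rewrite inE => /eqP ->.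
  by rewrite (merge_inr _ _ hC') //; apply: F2.
- apply/in_cat; split=> C' h; first by rewrite merge_inl //; apply: F1.
  by rewrite (merge_inr _ _ o2) //; apply: F2'.
move=> w rho P al /in_cat[A1 A2] /in_cat[B1 B2].
have [P0 Pj] := A1 C (mem_head _ _).
have X : {in vars t, forall j, (P C j.+1).2 = ev rho (fa C j)}.
  by move=> j; rewrite Hvars => /Pj.
have {}W1 := W1 w rho (P C) al (P C 0).2 B1 X.
have {}W2 := W2 w rho P al A2 B2.
have {}W2 : (forall C' t', (C', t') \in p ->
  run w (Df C') (P C') al t' (P C' 0).1 (P C' 0).2) <->
  _ := W2.
rewrite -P0 in W1; split.
  move=> H; have /W1[h1 h2 h3 h4] := H C t (mem_head _ _).
  have /W2[h5 h6 h7] : forall C' t', (C', t') \in p ->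
    run w (Df C') (P C') al t' (P C' 0).1 (P C' 0).2.
    by move=> C' t' h; apply: H; rewrite inE h orbT.
  split.
  - by rewrite /holds all_cat [all _ _]h1 [all _ _]h5.
  - apply/in_cat; split=> C' h; last by rewrite (merge_inr _ _ hC') //; apply: h6.
    rewrite merge_inl //; move: h; rewrite inE => /eqP -> [_|j hj].
      by rewrite /ev2 /= -P0 -h2 -surjective_pairing.
    by rewrite /ev2 /= -h4 ?Hvars // -Pj // -surjective_pairing.
  - apply/in_cat; split=> C' h; first by rewrite merge_inl //; apply: h3.
    by rewrite (merge_inr _ _ o2) //; apply: h7.
rewrite /holds all_cat => -[/andP[h1 h5] /in_cat[h2 h6] /in_cat[h3 h7]].
have {}h2 := h2 C (mem_head _ _); rewrite merge_inl ?mem_head // in h2.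
have R1 : run w (Df C) (P C) al t (P C 0).1 (P C 0).2.
  apply/W1; split=> //.
  - by rewrite h2.
  - by move=> C' h; have := h3 C' h; rewrite merge_inl.
  - by move=> j; rewrite Hvars => hj; rewrite h2.
have R2 : forall C' t', (C', t') \in p -> run w (Df C') (P C') al t' (P C' 0).1 (P C' 0).2.
  apply/W2; split=> //.
  - by move=> C' h; have := h6 C' h; rewrite (merge_inr _ _ hC').
  - by move=> C' h; have := h7 C' h; rewrite (merge_inr _ _ o2).
by move=> C' t'; rewrite inE => /orP[/eqP[-> ->]|/R2].
Qed.

End Walk.

(** * Parametrizing the valid annotations of a rule by few positions *)

Section Template.
Variables (V T : eqType) (rk : T -> nat) (G : transducer V T).
Hypothesis wfG : wf rk G.
Variables (inN1 : pred V) (Delta : pred T).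
Notation rkN := (nt_rk G).
Notation degree := (mult G * (width G + 1) * (rule_width G + 1)).

Definition eva rho (sP : V -> sann) : V -> ann := fun C i => ev2 rho (sP C i).

Lemma rank_width C : C \in nts G -> rkN C <= width G.
Proof. by move=> hC; rewrite /width (big_rem C hC) leq_maxl. Qed.

Lemma size_mult A : A \in bigs G -> size A <= mult G.
Proof. by move=> hA; rewrite /mult (big_rem A hA) leq_maxl. Qed.

(** The nonterminals of the right-hand side are the disjoint union of at most [rule_width G] links,
    and each link, like the left-hand side, has at most [mult G] elements. *)
Lemma slots_bound (r : rule V T) : r \in rules G ->
  size (lhs r) + size (occN_forest (rhs r)) <= mult G * (rule_width G + 1).
Proof.
move=> Hr; have Hw := wf_rules wfG Hr.
have -> : size (occN_forest (rhs r)) = size (flatten (links r)).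
  apply: perm_size; apply: uniq_perm; first exact: wf_uniqN Hw.
    exact: (uniq_flatten_links wfG Hr).
  by move=> C; rewrite (wf_links_occ Hw).
rewrite addnC mulnDr muln1; apply: leq_add; last exact: (size_mult (lhs_bigs wfG Hr)).
have : size (links r) <= rule_width G.
  by rewrite /rule_width (big_rem r Hr) leq_maxl.
move=> hl; apply: (leq_trans _ (leq_mul (leqnn _) hl)).
have := wf_links_bigs Hw; elim: (links r) => [|B L IH] HB /=; first by rewrite muln0.
rewrite size_cat mulnS leq_add ?size_mult ?HB ?mem_head // IH // => B' hB'.
by rewrite HB // inE hB' orbT.
Qed.

(** Symbolic data, independent of [w], whose instances are valid and cover all bounded valid
    annotations of the rule. *)
Definition template (r : rule V T) cs (sP sal : V -> sann) :=
  (forall w rho, holds w rho cs -> valid inN1 Delta w r (eva rho sP) (eva rho sal)) /\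
  (forall w P al, bounded_on G w (lhs r) P -> bounded_on G w (occN_forest (rhs r)) al ->
     valid inN1 Delta w r P al ->
     exists rho, [/\ size rho = degree, all (fun i => i <= size w) rho, holds w rho cs,
       {in lhs r, forall C, agree rkN rho C (P C) (sP C)} &
       {in occN_forest (rhs r), forall C, agree rkN rho C (al C) (sal C)}]).

Lemma rule_template (r : rule V T) : r \in rules G ->
  exists cs sP sal, template r cs sP sal.
Proof.
move=> Hr; have Hw := wf_rules wfG Hr.
pose L := size (lhs r); pose K := width G + 1; pose occ := occN_forest (rhs r).
(* Each nonterminal owns a block of [K] consecutive slots, those of the left-hand side first. *)
pose slot i j := pvar (i * K + j).
pose fe C := slot (L + index C occ) 0; pose fb C j := slot (L + index C occ) j.+1.
pose fs C := slot (index C (lhs r)) 0; pose fa C j := slot (index C (lhs r)) j.+1.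
have Ez1 : unzip1 (zip (lhs r) (rhs r)) = lhs r by rewrite unzip1_zip // (wf_size Hw).
have Ez2 : unzip2 (zip (lhs r) (rhs r)) = rhs r by rewrite unzip2_zip // (wf_size Hw).
have [|||cs [sP [sal [FP Fal W]]]] := @walk_rule V T rkN rk fe fb (letters inN1 Delta) fs fa (zip (lhs r) (rhs r)).
- by rewrite Ez1; apply: (bigs_uniq wfG (lhs_bigs wfG Hr)).
- by move=> C t; apply: rule_pattern.
- by rewrite Ez2 (wf_uniqN Hw).
rewrite Ez1 Ez2 in FP Fal W.
have hK : 0 < K by rewrite /K addn1.
exists cs, sP, sal; split=> [w rho Hcs|w P al HP Hal Hv].
  apply: (proj2 (W w rho (eva rho sP) (eva rho sal) _ _)) => // C hC.
    have [h1 h2] := FP C hC; split; first by rewrite /eva /ev2 /= h1.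
    by move=> j /h2 h3; rewrite /eva /ev2 /= h3.
  have [h1 h2] := Fal C hC; split; first by rewrite /eva /ev2 /= h1.
  by move=> j /h2 h3; rewrite /eva /ev2 /= h3.
pose val_at i j : nat := if i < L then let C := nth (S1 G) (lhs r) i in
     (if j is j'.+1 then (P C j).2 else (P C 0).1)
   else let C := nth (S1 G) occ (i - L) in (if j is j'.+1 then (al C j).1 else (al C 0).2).
(* The environment is filled with the free positions of the given annotation; the minimum keeps
   slots without a meaning within 0..|w|. *)
pose rho := mkseq (fun v => minn (size w) (val_at (v %/ K) (v %% K))) degree.
have Erho i j : i < L + size occ -> j < K -> val_at i j <= size w ->
  ev rho (slot i j) = val_at i j.
  move=> hi hj hv; rewrite ev_var nth_mkseq.
    by rewrite divnMDl // divn_small // addn0 modnMDl modn_small //; apply/minn_idPr.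
  have : i < mult G * (rule_width G + 1) by apply: leq_trans hi (slots_bound Hr).
  move=> hi'; rewrite mulnAC -/K.
  by apply: leq_trans (leq_mul hi' (leqnn K)); rewrite mulSn addnC ltn_add2r.
have hKr C j : C \in nts G -> j < rkN C -> j.+1 < K.
  by move=> /rank_width h1 h2; rewrite /K addn1 ltnS; apply: leq_trans h1.
have hlhs C : C \in lhs r -> [/\ C \in nts G,
  index C (lhs r) < L & nth (S1 G) (lhs r) (index C (lhs r)) = C].
  by move=> h; rewrite (lhs_nts wfG Hr h) index_mem h nth_index.
have hocc C : C \in occ -> [/\ C \in nts G,
  index C occ < size occ & nth (S1 G) occ (index C occ) = C].
  by move=> h; rewrite (occN_nts wfG Hr h) index_mem h nth_index.
have HP' : {in lhs r, forall C, free_lhs rkN fs fa rho C (P C)}.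
  move=> C hC; have [h1 h2 h3] := hlhs C hC.
  have hi : index C (lhs r) < L + size occ by apply: leq_trans h2 (leq_addr _ _).
  have E0 : val_at (index C (lhs r)) 0 = (P C 0).1 by rewrite /val_at h2 h3.
  have Ej j : val_at (index C (lhs r)) j.+1 = (P C j.+1).2 by rewrite /val_at h2 h3.
  have b0 : (P C 0).1 <= size w by have /andP[] := HP C hC 0 isT.
  split=> [|j hj]; first by rewrite -E0 [RHS]Erho // E0.
  have bj : (P C j.+1).2 <= size w by have /andP[] := HP C hC j.+1 hj.
  by rewrite -Ej [RHS]Erho ?Ej // (hKr C).
have Hal' : {in occ, forall C, free_al rkN fe fb rho C (al C)}.
  move=> C hC; have [h1 h2 h3] := hocc C hC.
  have hi : L + index C occ < L + size occ by rewrite ltn_add2l.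
  have hn : (L + index C occ < L) = false by rewrite ltnNge leq_addr.
  have E0 : val_at (L + index C occ) 0 = (al C 0).2 by rewrite /val_at hn addKn h3.
  have Ej j : val_at (L + index C occ) j.+1 = (al C j.+1).1 by rewrite /val_at hn addKn h3.
  have b0 : (al C 0).2 <= size w by have /andP[] := Hal C hC 0 isT.
  split=> [|j hj]; first by rewrite -E0 [RHS]Erho // E0.
  have bj : (al C j.+1).1 <= size w by have /andP[] := Hal C hC j.+1 hj.
  by rewrite -Ej [RHS]Erho ?Ej // (hKr C).
have [h1 h2 h3] := proj1 (W w rho P al HP' Hal') Hv.
exists rho; split=> //; first by rewrite size_mkseq.
by rewrite /rho /mkseq all_map; apply/allP => v _ /=; apply: geq_minl.
Qed.

End Template.

(** * Programs writing sequences *)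

Section Emission.
Variable T : finType.
Implicit Types (w : seq T) (rho : seq nat) (f g : seq T -> seq nat -> seq nat).

Definition same_regs e (s s' : state) := forall i, i < e -> mem_of s' i = mem_of s i.

(* Some command writes [f w rho] in time O(n^d), where w is the input and rho *)
(* the contents of the registers below e, which are preserved.                *)
Definition emits d e f := exists c k, forall w rho s,
  size rho = e -> (forall i, i < e -> mem_of s i = nth 0 rho i) ->
  exists s' t, [/\ exec (enc_word w) c s s' t, same_regs e s s',
    out_of s' = out_of s ++ f w rho & t <= k * (size w).+1 ^ d].

Lemma emits_ext d e f g : (forall w rho, size rho = e -> f w rho = g w rho) ->
  emits d e f -> emits d e g.
Proof.
move=> E [c [k H]]; exists c, k => w rho s hs hm.
by have [s' [t [h1 h2 h3 h4]]] := H w rho s hs hm; exists s', t; rewrite -E.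
Qed.

Lemma emits_le d d' e f : d <= d' -> emits d e f -> emits d' e f.
Proof.
move=> hd [c [k H]]; exists c, k => w rho s hs hm.
have [s' [t [h1 h2 h3 h4]]] := H w rho s hs hm; exists s', t; split=> //.
by apply: leq_trans h4 _; rewrite leq_mul2l leq_pexp2l ?orbT.
Qed.

Lemma emits_nil d e : emits d e (fun _ _ => [::]).
Proof.
exists CSkip, 1 => w rho s hs hm; exists s, 1; split=> //; first exact: ExSkip.
  by rewrite cats0.
by rewrite mul1n expn_gt0.
Qed.

Lemma emits_cat d e f g : emits d e f -> emits d e g ->
  emits d e (fun w rho => f w rho ++ g w rho).
Proof.
move=> [c1 [k1 H1]] [c2 [k2 H2]]; exists (CSeq c1 c2), (k1 + k2) => w rho s hs hm.
have [s1 [t1 [x1 r1 o1 b1]]] := H1 w rho s hs hm.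
have [|s2 [t2 [x2 r2 o2 b2]]] := H2 w rho s1 hs.
  by move=> i hi; rewrite r1 // hm.
exists s2, (t1 + t2); split.
- exact: ExSeq x1 x2.
- by move=> i hi; rewrite r2 // r1.
- by rewrite o2 o1 catA.
- by rewrite mulnDl leq_add.
Qed.

Lemma emits_flatten (A : Type) (d e : nat) (h : A -> seq T -> seq nat ->
  seq nat) (s : seq A) :
  allProp (fun x => emits d e (h x)) s ->
  emits d e (fun w rho => flatten [seq h x w rho | x <- s]).
Proof.
elim: s => [_|x s IH [h1 /IH h2]] /=; first exact: emits_nil.
exact: emits_cat h1 h2.
Qed.

(** Register [e] is the first one not holding the environment. An index outside the environment
    evaluates to 0, so only the constant is loaded. *)
Lemma load_pexp e (p : pexp) : exists c, forall inp rho s,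
  size rho = e -> (forall i, i < e -> mem_of s i = nth 0 rho i) ->
  exists s' t, [/\ exec inp c s s' t, mem_of s' e = ev rho p, same_regs e s s',
    out_of s' = out_of s & t <= 2].
Proof.
case: p => [[v|] c]; last first.
  exists (CSet e c) => inp rho s hs hm; exists (upd s e c), 1; split=> //=.
  - exact: ExSet.
  - by rewrite eqxx.
  - by move=> i hi /=; rewrite ltn_eqF.
case: (ltnP v e) => hv.
  exists (CSeq (CSet e c) (CAdd e v e)) => inp rho s hs hm.
  exists (upd (upd s e c) e (mem_of (upd s e c) v + mem_of (upd s e c) e)), (1 + 1);
    split=> //=.
  - by apply: ExSeq; [apply: ExSet | apply: ExAdd].
  - by rewrite !eqxx ltn_eqF // hm.
  - by move=> i hi /=; rewrite ltn_eqF.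
exists (CSet e c) => inp rho s hs hm; exists (upd s e c), 1; split=> //=.
- exact: ExSet.
- by rewrite eqxx /ev /= nth_default ?hs.
- by move=> i hi /=; rewrite ltn_eqF.
Qed.

Lemma emits_pexp e (p : pexp) : emits 0 e (fun _ rho => [:: ev rho p]).
Proof.
have [c Hc] := load_pexp e p.
exists (CSeq c (CWrite e)), 3 => w rho s hs hm.
have [s1 [t [h1 h2 h3 h4 h5]]] := Hc (enc_word w) rho s hs hm.
exists (State (mem_of s1) (rcons (out_of s1) (mem_of s1 e))), (t + 1); split=> //=.
- exact: ExSeq h1 (ExWrite _ _ _).
- by rewrite h2 h4 cats1.
- by rewrite addn1 expn0 muln1 ltnS.
Qed.

Lemma emits_len e : emits 0 e (fun w _ => [:: size w]).
Proof.
exists (CSeq (CLen e) (CWrite e)), 2 => w rho s hs hm.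
exists (State (mem_of (upd s e (size w))) (rcons (out_of s) (size w))), (1 + 1).
have E : size w = size (enc_word w) by rewrite size_map.
split=> //=.
- apply: ExSeq; first exact: ExLen.
  have := ExWrite (enc_word w) e (upd s e (size (enc_word w))).
  by rewrite /= eqxx -E.
- by move=> i hi /=; rewrite ltn_eqF.
- by rewrite cats1.
Qed.

Lemma enc_letter_inj : injective (@enc_letter T).
Proof. by move=> a b /val_inj; apply: enum_rank_inj. Qed.

(** The position is first checked to lie inside the input, because reading beyond it returns 0, a
    possible letter code. Equality is then tested by adding the two truncated differences; letter
    codes are injective. *)
Lemma emits_guard d e (c : pexp * T) f : emits d e f ->
  emits d e (fun w rho => if onth w (ev rho c.1) == Some c.2 then f w rho else [::]).
Proof.
case: c => p a [c1 [k1 H1]]; have [c Hc] := load_pexp e p.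
pose cmp := CSeq (CRead e.+1 e) (CSeq (CSet e.+2 (enc_letter a))
   (CSeq (CSub e.+3 e.+1 e.+2) (CSeq (CSub e.+2 e.+2 e.+1)
   (CSeq (CAdd e.+3 e.+3 e.+2) (CIf e.+3 CSkip c1))))).
exists (CSeq c (CSeq (CLen e.+1) (CSeq (CSub e.+1 e.+1 e) (CIf e.+1 cmp CSkip)))),
  (k1 + 20) => w rho s hs hm.
have [s1 [t [h1 h2 h3 h4 h5]]] := Hc (enc_word w) rho s hs hm.
set n := (size w).+1 ^ d; have n0 : 0 < n by rewrite expn_gt0.
have Esz : size (enc_word w) = size w by rewrite size_map.
pose s2 := upd s1 e.+1 (size w); pose s3 := upd s2 e.+1 (mem_of s2 e.+1 - mem_of s2 e).
have x2 : exec (enc_word w) (CLen e.+1) s1 s2 1 by rewrite /s2 -Esz; apply: ExLen.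
have x3 : exec (enc_word w) (CSub e.+1 e.+1 e) s2 s3 1 by apply: ExSub.
have E3 : mem_of s3 e.+1 = size w - ev rho p.
  by rewrite /= eqxx (ltn_eqF (ltnSn e)) h2.
have r3 i : i <= e -> mem_of s3 i = mem_of s1 i.
  by move=> hi /=; rewrite ltn_eqF.
case: (ltnP (ev rho p) (size w)) => hp; last first.
  rewrite onth_default //=; exists s3, (t + (1 + (1 + (1.+1)))); split.
  - apply: ExSeq h1 _; apply: ExSeq x2 _; apply: ExSeq x3 _; apply: ExIfF;
      last exact: ExSkip.
    by rewrite E3; apply/eqP; rewrite subn_eq0.
  - by move=> i hi; rewrite r3 ?h3 // ltnW.
  - by rewrite cats0.
  - apply: leq_trans (_ : 20 * n <= _); last by rewrite mulnDl leq_addl.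
    by lia.
pose b := nth 0 (enc_word w) (mem_of s3 e).
pose s4 := upd s3 e.+1 b; pose s5 := upd s4 e.+2 (enc_letter a).
pose s6 := upd s5 e.+3 (mem_of s5 e.+1 - mem_of s5 e.+2).
pose s7 := upd s6 e.+2 (mem_of s6 e.+2 - mem_of s6 e.+1).
pose s8 := upd s7 e.+3 (mem_of s7 e.+3 + mem_of s7 e.+2).
have Eb : b = enc_letter (nth a w (ev rho p)).
  by rewrite /b r3 // h2 (nth_map a).
have Eon : (onth w (ev rho p) == Some a) = (mem_of s8 e.+3 == 0).
  have -> : mem_of s8 e.+3 = (b - enc_letter a) + (enc_letter a - b).
    have N1 : (e.+1 == e.+2) = false by lia.
    have N2 : (e.+1 == e.+3) = false by lia.
    have N3 : (e.+2 == e.+3) = false by lia.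
    have N4 : (e.+3 == e.+2) = false by lia.
    have N5 : (e.+2 == e.+1) = false by lia.
    by rewrite /= !(eqxx, N1, N2, N3, N4, N5).
  rewrite addn_eq0 !subn_eq0 -eqn_leq Eb (inj_eq enc_letter_inj).
  case E: (onth w (ev rho p)) => [a'|]; first by rewrite (onth_nth a _ _ _ E).
  by have := onthTE w (ev rho p); rewrite hp E.
have r8 i : i < e -> mem_of s8 i = mem_of s i.
  move=> hi; have M1 : (i == e.+1) = false by lia.
  have M2 : (i == e.+2) = false by lia.
  have M3 : (i == e.+3) = false by lia.
  by rewrite /= !(M1, M2, M3) h3.
have x8 c' s' t' : exec (enc_word w) c' s8 s' t' ->
   exec (enc_word w) (CSeq (CRead e.+1 e) (CSeq (CSet e.+2 (enc_letter a))
   (CSeq (CSub e.+3 e.+1 e.+2) (CSeq (CSub e.+2 e.+2 e.+1)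
   (CSeq (CAdd e.+3 e.+3 e.+2) c'))))) s3 s' (1 + (1 + (1 + (1 + (1 + t'))))).
  move=> x; apply: ExSeq (ExRead _ _ _ _) _; apply: ExSeq (ExSet _ _ _ _) _.
  apply: ExSeq (ExSub _ _ _ _ _) _; apply: ExSeq (ExSub _ _ _ _ _) _.
  exact: ExSeq (ExAdd _ _ _ _ _) x.
have x3' : mem_of s3 e.+1 != 0 by rewrite E3 subn_eq0 -ltnNge.
rewrite [(_, _).1]/= [(_, _).2]/= Eon; case: eqP => E8.
  have [|s9 [t9 [y1 y2 y3 y4]]] := H1 w rho s8 hs.
    by move=> i hi; rewrite r8 // hm.
  eexists s9, _; split.
  - apply: ExSeq h1 _; apply: ExSeq x2 _; apply: ExSeq x3 _; apply: ExIfT x3' _.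
    by apply: x8; apply: ExIfF E8 y1.
  - by move=> i hi; rewrite y2 // r8.
  - by rewrite y3 /= h4.
  - by rewrite -/n mulnDl in y4 *; lia.
eexists s8, _; split.
- apply: ExSeq h1 _; apply: ExSeq x2 _; apply: ExSeq x3 _; apply: ExIfT x3' _.
  by apply: x8; apply: ExIfT (ExSkip _ _); apply/eqP.
- exact: r8.
- by rewrite cats0.
- apply: leq_trans (_ : 20 * n <= _); last by rewrite mulnDl leq_addl.
  by lia.
Qed.

Lemma emits_guards d e (cs : seq (pexp * T)) f : emits d e f ->
  emits d e (fun w rho => if holds w rho cs then f w rho else [::]).
Proof.
move=> H; elim: cs => [|c cs IH] /=; first exact: emits_ext H.
apply: emits_ext (emits_guard c IH) => w rho _ /=.
by case: (_ == _).
Qed.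

(** Register [e] becomes the loop variable and thereby the last entry of the environment of the
    body; |w| + 1 passes raise the degree by one. *)
Lemma emits_loop d e f : emits d e.+1 f ->
  emits d.+1 e (fun w rho => flatten [seq f w (rcons rho i) | i <- iota 0 (size w).+1]).
Proof.
move=> [c [k H]].
(* The number of remaining passes is recomputed after each pass, since the body may overwrite all
   registers above [e]. *)
pose test := CSeq (CLen e.+1) (CSeq (CSet e.+2 1) (CSeq (CAdd e.+1 e.+1 e.+2) (CSub e.+1 e.+1 e))).
pose incr := CSeq (CSet e.+1 1) (CAdd e e e.+1).
pose loop := CWhile e.+1 (CSeq c (CSeq incr test)).
exists (CSeq (CSet e 0) (CSeq test loop)), (k + 20) => w rho s hs hm.
set N := (size w).+1; set n := N ^ d.
have n0 : 0 < n by rewrite expn_gt0.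
have Htest s0 : exists s1, [/\ exec (enc_word w) test s0 s1 4, same_regs e.+1 s0 s1,
    mem_of s1 e.+1 = N - mem_of s0 e & out_of s1 = out_of s0].
  eexists; split; first exact: (ExSeq (ExLen _ _ _) (ExSeq (ExSet _ _ _ _)
      (ExSeq (ExAdd _ _ _ _ _) (ExSub _ _ _ _ _)))).
  - move=> i hi /=; have -> : (i == e.+1) = false by lia.
    by have -> : (i == e.+2) = false by lia.
  - rewrite /= !eqxx.
    have -> : (e.+1 == e.+2) = false by lia.
    have -> : (e == e.+1) = false by lia.
    have -> : (e == e.+2) = false by lia.
    by rewrite size_map addn1.
  - by [].
have Hincr s0 : exists s1, [/\ exec (enc_word w) incr s0 s1 2, same_regs e s0 s1,
    mem_of s1 e = (mem_of s0 e).+1 & out_of s1 = out_of s0].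
  eexists; split; first exact: (ExSeq (ExSet _ _ _ _) (ExAdd _ _ _ _ _)).
  - by move=> i hi /=; rewrite !ltn_eqF //; lia.
  - by rewrite /= !eqxx ltn_eqF // addn1.
  - by [].
have Hloop m : forall j s0, j + m = N -> mem_of s0 e = j -> mem_of s0 e.+1 = m ->
    (forall i, i < e -> mem_of s0 i = nth 0 rho i) ->
    exists s1 t, [/\ exec (enc_word w) loop s0 s1 t, same_regs e s0 s1,
      out_of s1 = out_of s0 ++ flatten [seq f w (rcons rho i) | i <- iota j m] &
      t <= m * (k * n + 7) + 1].
  elim: m => [|m IH] j s0 hjm h1 h2 h3.
    by exists s0, 1; split=> //; [apply: ExWhileF | rewrite cats0].
  have [||sa [ta [xa ra oa ba]]] := H w (rcons rho j) s0.
  - by rewrite size_rcons hs.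
  - move=> i; rewrite ltnS nth_rcons hs leq_eqVlt => /orP[/eqP ->|hi].
      by rewrite ltnn eqxx.
    by rewrite hi h3.
  have [sb [xb rb mb ob]] := Hincr sa.
  have [sc [xc rc mc oc]] := Htest sb.
  have hce : mem_of sc e = j.+1 by rewrite rc // mb ra // h1.
  have [|||sd [td [xd rd od bd]]] := IH j.+1 sc _ hce.
  - by rewrite addSnnS.
  - by rewrite mc mb ra // h1; lia.
  - by move=> i hi; rewrite rc ?rb ?ra ?h3 // ltnW // ltnS ltnW.
  exists sd, ((ta + (2 + 4)) + td).+1; split.
  - apply: ExWhileT xd; first by rewrite h2.
    by apply: ExSeq xa _; apply: ExSeq xb xc.
  - by move=> i hi; rewrite rd ?rc ?rb ?ra // ltnW // ltnS ltnW.
  - by rewrite od oc ob oa -catA.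
  - by rewrite -/n in ba; rewrite mulSn; lia.
have [sa [xa ra ma oa]] := Htest (upd s e 0).
have ha : mem_of sa e = 0 by rewrite ra //= eqxx.
have [|||sb [tb [xb rb ob bb]]] := Hloop N 0 sa _ ha.
- by [].
- by rewrite ma /= eqxx subn0.
- by move=> i hi; rewrite ra /= ?ltn_eqF ?hm // ltnW.
exists sb, (1 + (4 + tb)); split.
- by apply: ExSeq (ExSet _ _ _ _) _; apply: ExSeq xa xb.
- by move=> i hi; rewrite rb // ra /= ?ltn_eqF // ltnW.
- by rewrite ob oa.
- rewrite expnS -/n; have N0 : 0 < N by []. 
  have hNn : N <= N * n by rewrite leq_pmulr.
  (* The constant 13 collects 7 steps of overhead per pass and 6 steps outside: initialization,
     first test and final exit. *)
  rewrite mulnDl; apply: leq_trans (_ : k * (N * n) + 13 * (N * n) <= _); last by lia.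
  by move: bb; rewrite mulnDr mulnCA; lia.
Qed.

Fixpoint envs (n D : nat) : seq (seq nat) :=
  if D is D'.+1 then flatten [seq map (cons i) (envs n D') | i <- iota 0 n.+1]
  else [:: [::]].

Lemma mem_envs n D rho : size rho = D -> all (fun i => i <= n) rho -> rho \in envs n D.
Proof.
elim: D rho => [|D IH] [|i rho] // [hs] /andP[hi hr].
apply/flattenP; exists (map (cons i) (envs n D)); last by rewrite map_f // IH.
by apply: (map_f (fun i => map (cons i) (envs n D))); rewrite mem_iota.
Qed.

Lemma emits_envs D d e f : emits d (e + D) f ->
  emits (d + D) e (fun w rho => flatten [seq f w (rho ++ sg) | sg <- envs (size w) D]).
Proof.
elim: D e => [|D IH] e.
  rewrite !addn0; apply: emits_ext => w rho _ /=; by rewrite !cats0.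
rewrite -addSnnS => /IH/emits_loop; rewrite addnS; apply: emits_ext => w rho _ /=.
have E i : flatten [seq f w (rcons rho i ++ sg) | sg <- envs (size w) D] =
  flatten [seq f w (rho ++ sg) | sg <- map (cons i) (envs (size w) D)].
  by rewrite -map_comp; congr flatten; apply: eq_map => sg /=; rewrite cat_rcons.
rewrite map_cat flatten_cat E; congr (_ ++ _).
rewrite map_flatten -!map_comp; elim: (iota 1 _) => //= i l IHl.
by rewrite flatten_cat IHl E.
Qed.

End Emission.

(** * Writing the annotated grammars *)

Lemma arule_ext (V : eqType) W T (g1 g2 g1' g2' : V -> W) (r : rule V T) :
  {in lhs r, g1 =1 g2} -> {in occN_forest (rhs r), g1' =1 g2'} ->
  {in flatten (links r), g1' =1 g2'} -> arule g1 g1' r = arule g2 g2' r.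
Proof.
move=> h1 h2 h3; congr (_, _, _).
- exact/eq_in_map.
- move: h2; elim: (rhs r) => //= t u IH h2; congr (_ :: _).
    by apply: eq_in_rn => C hC; apply: h2; rewrite occN_forest_cons mem_cat hC.
  by apply: IH => C hC; apply: h2; rewrite occN_forest_cons mem_cat hC orbT.
- apply/eq_in_map => B hB; apply/eq_in_map => C hC; apply: h3.
  by apply/flattenP; exists B.
Qed.

Lemma enc_seq_map A B (f : B -> seq nat) (g : A -> B) s :
  enc_seq f (map g s) = enc_seq (f \o g) s.
Proof. by rewrite /enc_seq -map_comp. Qed.

Lemma flatten_map_flatten A B (h : A -> seq B) ss :
  flatten (map h (flatten ss)) = flatten [seq flatten (map h s) | s <- ss].
Proof. by elim: ss => //= s ss IH; rewrite map_cat flatten_cat IH. Qed.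

Lemma flatten_flatten A (ss : seq (seq (seq A))) :
  flatten (flatten ss) = flatten (map flatten ss).
Proof. by elim: ss => //= s ss IH; rewrite flatten_cat IH. Qed.

Section Encoders.
Variables (T : finType) (V : Type).

Lemma emits_const e (l : seq nat) : emits (T := T) 0 e (fun _ _ => l).
Proof.
apply: (emits_ext (f := fun _ rho => flatten [seq [:: ev rho (None, c)] | c <- l])).
  by move=> w rho _; elim: l => //= c l ->.
by apply: emits_flatten; elim: l => //= c l IH; split=> //; apply: emits_pexp.
Qed.

Lemma emits_enc_seq A d e (h : A -> seq T -> seq nat -> seq nat) s :
  allProp (fun x => emits d e (h x)) s ->
  emits d e (fun w rho => enc_seq (fun x => h x w rho) s).
Proof.
move=> H; apply: emits_cat; last exact: emits_le (emits_const _ _).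
apply: (emits_flatten (h := fun x w rho => 1 :: h x w rho)).
elim: s H => //= x s IH [h1 /IH h2]; split=> //.
exact: emits_cat (emits_le (leq0n _) (emits_const _ [:: 1])) h1.
Qed.

Lemma allProp_intro A (P : A -> Prop) s : (forall x, P x) -> allProp P s.
Proof. by move=> H; elim: s => //= x s IH; split. Qed.

(* A number in a name: a symbolic position, or the length of the input. *)
Definition atom (w : seq T) rho (p : option pexp) := oapp (ev rho) (size w) p.

Lemma emits_atom e p : emits 0 e (fun w rho => [:: atom w rho p]).
Proof. by case: p => [p|]; [apply: emits_pexp | apply: emits_len]. Qed.

Lemma emits_name e x : emits 0 e (fun w rho => enc_name (map (atom w rho) x)).
Proof.
apply: (emits_ext (f := fun w rho => enc_seq (fun p => [:: atom w rho p]) x)).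
  by move=> w rho _; rewrite /enc_name enc_seq_map.
by apply: emits_enc_seq; apply: allProp_intro => p; apply: emits_atom.
Qed.

Variables (g g' : V -> seq (option pexp)).

Lemma emits_names e A :
  emits 0 e (fun w rho => enc_seq enc_name [seq map (atom w rho) (g C) | C <- A]).
Proof.
apply: (emits_ext (f := fun w rho => enc_seq (fun C =>
  enc_name (map (atom w rho) (g C))) A)).
  by move=> w rho _; rewrite enc_seq_map.
by apply: emits_enc_seq; apply: allProp_intro => C; apply: emits_name.
Qed.

(** The length of an annotated name depends only on the rank, so the length prefix is a constant of
    the program. *)
Lemma emits_hname e A :
  emits 0 e (fun w rho => enc_name (hname [seq map (atom w rho) (g C) | C <- A])).
Proof.
apply: (emits_ext (f := fun w rho => enc_name (map (atom w rho)
   (flatten [seq Some (None, size (g C)) :: g C | C <- A])))); last exact: emits_name.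
move=> w rho _; congr enc_name; rewrite /hname map_flatten -!map_comp.
by congr flatten; apply: eq_map => C /=; rewrite size_map.
Qed.

Lemma emits_tree e (t : tree (sym V T)) : emits 0 e (fun w rho =>
  enc_tree (tree_map (rn (fun C => map (atom w rho) (g' C))) t)).
Proof.
elim/tree_ind_all: t => c ts IH.
apply: (emits_ext (f := fun w rho => enc_sym (rn (fun C => map (atom w rho) (g' C)) c) ++
  enc_seq (fun t => enc_tree (tree_map (rn (fun C => map (atom w rho) (g' C))) t)) ts)).
  by move=> w rho _ /=; rewrite enc_seq_map.
apply: emits_cat; last exact: emits_enc_seq.
case: c {IH} => [C|a|i]; try exact: emits_const.
exact: emits_cat (emits_const _ [:: 0]) (emits_name _ _).
Qed.

Lemma emits_rule e (r : rule V T) : emits 0 e (fun w rho =>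
  enc_rule (arule (fun C => map (atom w rho) (g C)) (fun C => map (atom w rho) (g' C)) r)).
Proof.
apply: (emits_ext (f := fun w rho =>
  enc_seq enc_name [seq map (atom w rho) (g C) | C <- lhs r] ++
  enc_seq (fun t => enc_tree (tree_map (rn (fun C =>
    map (atom w rho) (g' C))) t)) (rhs r) ++
  enc_seq (fun B => enc_seq (fun C => enc_name (map (atom w rho) (g' C))) B) (links r))).
  move=> w rho _; rewrite /enc_rule /arule /lhs /rhs /links /= !enc_seq_map.
  congr (_ ++ (_ ++ _)); rewrite /enc_seq; congr (flatten _ ++ _).
  by apply: eq_map => B /=; rewrite -map_comp.
apply: emits_cat; first exact: emits_names.
apply: emits_cat.
  by apply: emits_enc_seq; apply: allProp_intro => t; apply: emits_tree.
apply: emits_enc_seq; apply: allProp_intro => B.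
by apply: emits_enc_seq; apply: allProp_intro => C; apply: emits_name.
Qed.

End Encoders.
Arguments emits_const {T}.
Arguments emits_name {T}.
Arguments emits_names {T V}.
Arguments emits_hname {T V}.

(** Selects one template per rule without a choice axiom, as the rules form a finite list. *)
Lemma finite_choice (A : eqType) B (b0 : B) (Q : A -> B -> Prop) (s : seq A) :
  (forall x, x \in s -> exists b, Q x b) -> exists F, forall x, x \in s -> Q x (F x).
Proof.
elim: s => [|x s IH] H; first by exists (fun=> b0).
have [|F HF] := IH; first by move=> y hy; apply: H; rewrite inE hy orbT.
have [b hb] := H x (mem_head _ _).
exists (fun y => if y == x then b else F y) => y; rewrite inE.
by case: eqP => [-> _ //|_ /= /HF].
Qed.

(** * Listing the annotated rules and writing both grammars *)

Section Output.
Variables (V : eqType) (T : finType) (rk : T -> nat) (G : transducer V T).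
Hypothesis wfG : wf rk G.
Variables (inN1 : pred V) (Delta : pred T).
Notation rkN := (nt_rk G).
Notation degree := (mult G * (width G + 1) * (rule_width G + 1)).

Variables (conds : rule V T -> seq (pexp * T)) (sP sal : rule V T -> V -> sann).
Hypothesis conds_valid : forall r, r \in rules G -> forall w rho,
  holds w rho (conds r) -> valid inN1 Delta w r (eva rho (sP r)) (eva rho (sal r)).
Hypothesis valid_conds : forall r, r \in rules G -> forall w P al,
  bounded_on G w (lhs r) P -> bounded_on G w (occN_forest (rhs r)) al ->
  valid inN1 Delta w r P al ->
  exists rho, [/\ size rho = degree, all (fun i => i <= size w) rho, holds w rho (conds r),
    {in lhs r, forall C, agree rkN rho C (P C) (sP r C)} &
    {in occN_forest (rhs r), forall C, agree rkN rho C (al C) (sal r C)}].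

Definition inst rho (r : rule V T) : rule V T * rule (seq nat) T :=
  (r, arule (nmf G (eva rho (sP r))) (nmf G (eva rho (sal r))) r).

Definition insts w := flatten [seq flatten
  [seq if holds w rho (conds r) then [:: inst rho r] else [::] | r <- rules G]
    | rho <- envs (size w) degree].

Lemma insts_valid w r r' : (r, r') \in insts w -> r \in rules G /\
  exists P al, valid inN1 Delta w r P al /\ r' = arule (nmf G P) (nmf G al) r.
Proof.
case/flattenP=> _ /mapP[rho _ ->] /flattenP[_ /mapP[r0 Hr0 ->]].
case: ifP => // Hc; rewrite inE => /eqP[-> ->]; split=> //.
by exists (eva rho (sP r0)), (eva rho (sal r0)); split=> //; apply: conds_valid.
Qed.

Lemma nmf_ext P P' C : (forall i, i <= rkN C -> P C i = P' C i) -> nmf G P C = nmf G P' C.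
Proof.
move=> H; rewrite /nmf /nm; congr (_ :: flatten _); apply/eq_in_map => i.
by rewrite mem_iota add0n ltnS => /H ->.
Qed.

Lemma valid_insts w r P al : r \in rules G ->
  bounded_on G w (lhs r) P -> bounded_on G w (occN_forest (rhs r)) al ->
  valid inN1 Delta w r P al -> (r, arule (nmf G P) (nmf G al) r) \in insts w.
Proof.
move=> Hr hP hal Hv; have [rho [h1 h2 h3 h4 h5]] := valid_conds Hr hP hal Hv.
apply/flattenP; eexists; first by apply: map_f; apply: mem_envs h1 h2.
apply/flattenP; exists [:: inst rho r].
  by apply/mapP; exists r; rewrite // h3.
rewrite inE /inst; apply/eqP; congr (_, _); apply: arule_ext => C hC;
  apply: nmf_ext => i hi.
- by rewrite h4.
- by rewrite h5.
- by rewrite h5 // -(wf_links_occ (wf_rules wfG Hr)).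
Qed.

Notation Gww w := (Gw G w (insts w)).
Notation Hww w := (Hw G w (insts w)).

(** One loop per free position; for a given environment, the fixed finite set of rules is handled by
    straight-line guarded code in constant time. *)
Lemma emits_insts (h : rule V T * rule (seq nat) T -> seq nat) :
  (forall r, r \in rules G -> emits 0 degree (fun (w : seq T) rho => h (inst rho r))) ->
  emits degree 0 (fun (w : seq T) _ => flatten (map h (insts w))).
Proof.
move=> H; pose f w rho := flatten [seq (if holds w rho (conds r) then h (inst rho r) else [::]) | r <- rules G].
have : emits 0 degree f.
  apply: (emits_flatten (h := fun r w rho =>
    if holds w rho (conds r) then h (inst rho r) else [::])).
  have : {subset rules G <= rules G} by [].
  elim: {1 3}(rules G) => //= r rs IH Hs; split.
    by apply: emits_guards; apply: H; apply: Hs; apply: mem_head.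
  by apply: IH => r' hr; apply: Hs; rewrite inE hr orbT.
move=> /(emits_envs (e := 0))/emits_ext; apply=> w rho /size0nil ->.
rewrite /insts flatten_map_flatten -map_comp; congr flatten; apply: eq_map => sg /=.
rewrite /f flatten_map_flatten -map_comp; congr flatten; apply: eq_map => r /=.
by case: ifP => //=; rewrite cats0.
Qed.

(** Common form of the listed parts of the output: start items followed by a few items per annotated
    rule. Each part is produced by its own enumeration, which leaves the degree unchanged. *)
Lemma emits_section X (e : X -> seq nat) (s0 : seq T -> seq X) k :
  emits 0 0 (fun (w : seq T) _ => flatten [seq 1 :: e x | x <- s0 w]) ->
  (forall r, r \in rules G -> emits 0 degree (fun (w : seq T) rho =>
    flatten [seq 1 :: e x | x <- k (inst rho r)])) ->
  emits degree 0 (fun w _ => enc_seq e (s0 w ++ flatten [seq k p | p <- insts w])).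
Proof.
move=> H0 H; apply: (emits_ext (f := fun w _ => flatten [seq 1 :: e x | x <- s0 w] ++
   (flatten [seq flatten [seq 1 :: e x | x <- k p] | p <- insts w] ++ [:: 0]))).
  move=> w rho _; rewrite /enc_seq map_cat flatten_cat -catA; congr (_ ++ (_ ++ _)).
  by rewrite flatten_map_flatten -map_comp.
apply: emits_cat; first exact: emits_le H0.
apply: emits_cat; last exact: emits_le (emits_const 0 _).
exact: emits_insts.
Qed.

Definition sname (y : V -> sann) C : seq (option pexp) :=
  Some (None, index C (nts G)) ::
  flatten [seq [:: Some (y C i).1; Some (y C i).2] | i <- iota 0 (rkN C).+1].

Lemma nmf_atoms (w : seq T) rho y : nmf G (eva rho y) =1 fun C =>
  map (atom w rho) (sname y C).
Proof.
move=> C.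
have E : flatten [seq [:: (eva rho y C i).1; (eva rho y C i).2] | i <- iota 0 (rkN C).+1] =
  map (atom w rho) (flatten [seq [:: Some (y C i).1;
    Some (y C i).2] | i <- iota 0 (rkN C).+1]).
  by rewrite map_flatten -map_comp.
exact: (congr1 (cons (index C (nts G))) E).
Qed.

(** [None] stands for |w|, the only position in a start name that is not constant. *)
Definition start_name C : seq (option pexp) :=
  Some (None, index C (nts G)) ::
  flatten [seq [:: Some (None, 0); if C == S1 G then None else Some (None,
    0)] | i <- iota 0 (rkN C).+1].

Lemma start_atoms (w : seq T) rho :
  nmf G (start_ann G w) =1 fun C => map (atom w rho) (start_name C).
Proof.
move=> C.
have E : flatten [seq [:: (start_ann G w C i).1;
  (start_ann G w C i).2] | i <- iota 0 (rkN C).+1] =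
  map (atom w rho) (flatten [seq [:: Some (None, 0);
     if C == S1 G then None else Some (None, 0)] | i <- iota 0 (rkN C).+1]).
  by rewrite map_flatten -map_comp /start_ann; case: eqP.
exact: (congr1 (cons (index C (nts G))) E).
Qed.

Lemma emits_nmf e y C : emits (T := T) 0 e (fun _ rho => enc_name (nmf G (eva rho y) C)).
Proof.
apply: emits_ext (emits_name e (sname y C)) => w rho _.
by rewrite (nmf_atoms w).
Qed.

Lemma emits_nmfs e y A :
  emits (T := T) 0 e (fun _ rho => enc_seq enc_name (map (nmf G (eva rho y)) A)).
Proof.
apply: emits_ext (emits_names (sname y) e A) => w rho _.
by rewrite (eq_map (nmf_atoms w rho y)).
Qed.

Lemma emits_hnmf e y A :
  emits (T := T) 0 e (fun _ rho => enc_name (hname (map (nmf G (eva rho y)) A))).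
Proof.
apply: emits_ext (emits_hname (sname y) e A) => w rho _.
by rewrite (eq_map (nmf_atoms w rho y)).
Qed.

Lemma emits_start_name e C : emits (T := T) 0 e (fun w _ =>
  enc_name (nmf G (start_ann G w) C)).
Proof.
apply: emits_ext (emits_name e (start_name C)) => w rho _.
by rewrite (start_atoms w rho).
Qed.

Lemma emits_start_names e : emits (T := T) 0 e (fun w _ => enc_seq enc_name (start G w)).
Proof.
apply: emits_ext (emits_names start_name e [:: S1 G; S2 G]) => w rho _.
by rewrite /start (eq_map (start_atoms w rho)).
Qed.

Lemma emits_start_hname e : emits (T := T) 0 e (fun w _ => enc_name (hname (start G w))).
Proof.
apply: emits_ext (emits_hname start_name e [:: S1 G; S2 G]) => w rho _.
by rewrite /start (eq_map (start_atoms w rho)).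
Qed.

Lemma emits_cons d e (c : nat) (f : seq T -> seq nat -> seq nat) :
  emits d e f -> emits d e (fun w rho => c :: f w rho).
Proof. exact: emits_cat (emits_le (leq0n _) (emits_const e [:: c])). Qed.

Lemma emits_rcons d e (c : nat) (f : seq T -> seq nat -> seq nat) :
  emits d e f -> emits d e (fun w rho => rcons (f w rho) c).
Proof.
move=> H; apply: (emits_ext (f := fun w rho => f w rho ++ [:: c])).
  by move=> w rho _; rewrite cats1.
exact: emits_cat H (emits_le (leq0n _) (emits_const e _)).
Qed.

Lemma links_inst rho r : links (inst rho r).2 =
  map (map (nmf G (eva rho (sal r)))) (links r).
Proof. by []. Qed.

Lemma lhs_inst rho r : lhs (inst rho r).2 = map (nmf G (eva rho (sP r))) (lhs r).
Proof. by []. Qed.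

(** Annotating keeps the rank, which is therefore a constant of the program. *)
Lemma emits_ranked_nmf e y C : C \in nts G -> emits (T := T) 0 e (fun _ rho =>
  rcons (enc_name (nmf G (eva rho y) C)) (rkw G (nmf G (eva rho y) C))).
Proof.
move=> hC; apply: emits_ext (emits_rcons (rkN C) (emits_nmf e y C)) => w rho _.
by rewrite /rkw era_nmf.
Qed.

Lemma emits_ranked_nmfs e y A : {subset A <= nts G} -> emits (T := T) 0 e (fun _ rho =>
  flatten [seq 1 :: rcons (enc_name C) (rkw G C) | C <- map (nmf G (eva rho y)) A]).
Proof.
move=> HA; apply: (emits_ext (f := fun _ rho => flatten [seq 1 ::
   rcons (enc_name (nmf G (eva rho y) C)) (rkw G (nmf G (eva rho y) C)) | C <- A])).
  by move=> w rho _; rewrite -map_comp.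
apply: (emits_flatten (h := fun C (_ : seq T) rho =>
  1 :: rcons (enc_name (nmf G (eva rho y) C)) (rkw G (nmf G (eva rho y) C)))).
elim: A HA => //= C A IH HA; split.
  by apply: emits_cons; apply: emits_ranked_nmf; apply: HA; rewrite mem_head.
by apply: IH => C' h; apply: HA; rewrite inE h orbT.
Qed.

Lemma emits_Hw_nts : emits degree 0 (fun (w : seq T) _ =>
  enc_seq enc_name (rtg_nts (Hww w))).
Proof.
apply: (emits_ext (f := fun w _ => enc_seq enc_name ([:: hname (start G w)] ++
  flatten [seq map hname (lhs p.2 :: links p.2) | p <- insts w]))).
  by move=> w rho _; rewrite /= map_flatten -map_comp.
apply: emits_section => [|r Hr].
  apply: (emits_ext (f := fun w _ => 1 :: enc_name (hname (start G w)))).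
    by move=> w rho _; rewrite /= cats0.
  by apply: emits_cons; apply: emits_start_hname.
apply: (emits_ext (f := fun _ rho =>
  (1 :: enc_name (hname (map (nmf G (eva rho (sP r))) (lhs r)))) ++
  flatten [seq 1 :: enc_name (hname (map (nmf G (eva rho (sal r))) B)) | B <- links r])).
  by move=> w rho _; rewrite lhs_inst links_inst /= -!map_comp.
apply: emits_cat; first by apply: emits_cons; apply: emits_hnmf.
apply: (emits_flatten (h := fun B (_ : seq T) rho =>
  1 :: enc_name (hname (map (nmf G (eva rho (sal r))) B)))).
by apply: allProp_intro => B; apply: emits_cons; apply: emits_hnmf.
Qed.

Lemma emits_Hw_rules : emits degree 0 (fun (w : seq T) _ =>
  enc_seq (fun p : seq nat * rule V T * seq (seq nat) =>
        enc_name p.1.1 ++ index p.1.2 (rules G) :: enc_seq enc_name p.2) (rtg_rules (Hww w))).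
Proof.
pose enc (p : seq nat * rule V T * seq (seq nat)) :=
  enc_name p.1.1 ++ index p.1.2 (rules G) :: enc_seq enc_name p.2.
apply: (emits_ext (f := fun w _ => enc_seq enc ([::] ++
  flatten [seq [:: (hname (lhs p.2), p.1, map hname (links p.2))] | p <- insts w]))).
  move=> w rho _ /=; congr enc_seq.
  by elim: (insts w) => //= p l ->.
apply: emits_section => [|r Hr]; first exact: emits_nil.
apply: (emits_ext (f := fun _ rho =>
  1 :: enc_name (hname (map (nmf G (eva rho (sP r))) (lhs r))) ++ index r (rules G) ::
  enc_seq (fun B => enc_name (hname (map (nmf G (eva rho (sal r))) B))) (links r))).
  by move=> w rho _; rewrite lhs_inst links_inst /= cats0 /enc /= !enc_seq_map.
apply: emits_cons; apply: emits_cat; first exact: emits_hnmf.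
apply: emits_cons; apply: emits_enc_seq.
by apply: allProp_intro => B; apply: emits_hnmf.
Qed.

Lemma emits_Gw_nts : emits degree 0 (fun (w : seq T) _ =>
  enc_seq (fun C => rcons (enc_name C) (nt_rk (Gww w) C)) (nts (Gww w))).
Proof.
apply: (emits_ext (f := fun w _ => enc_seq (fun C => rcons (enc_name C) (rkw G C))
  (start G w ++ flatten [seq flatten (lhs p.2 :: links p.2) | p <- insts w]))).
  move=> w rho _; congr enc_seq.
  have := flatten_flatten [seq lhs p.2 :: links p.2 | p <- insts w].
  by rewrite -map_comp => /(congr1 (cat (start G w)))/esym.
apply: emits_section => [|r Hr].
  apply: (emits_ext (f := fun w _ =>
     (1 :: rcons (enc_name (nmf G (start_ann G w) (S1 G))) (rkN (S1 G))) ++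
     (1 :: rcons (enc_name (nmf G (start_ann G w) (S2 G))) (rkN (S2 G))))).
    by move=> w rho _; rewrite /= /rkw !era_nmf ?(S1_nts wfG) ?(S2_nts wfG) // cats0.
  by apply: emits_cat; apply: emits_cons; apply: emits_rcons; apply: emits_start_name.
apply: (emits_ext (f := fun w rho =>
  flatten [seq 1 :: rcons (enc_name C) (rkw G C) | C <- map (nmf G (eva rho (sP r))) (lhs r)] ++
  flatten [seq 1 :: rcons (enc_name C) (rkw G C) | C <- map (nmf G (eva rho (sal r))) (flatten (links r))])).
  by move=> w rho _; rewrite links_inst lhs_inst /= map_cat flatten_cat map_flatten.
by apply: emits_cat; apply: emits_ranked_nmfs;
  [apply: (lhs_nts wfG Hr) | apply: (flatten_links_nts wfG Hr)].
Qed.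

Lemma emits_Gw_bigs : emits degree 0 (fun (w : seq T) _ =>
  enc_seq (enc_seq enc_name) (bigs (Gww w))).
Proof.
apply: (emits_section (e := enc_seq enc_name) (s0 := fun w => [:: start G w]) (k :=
  fun p => lhs p.2 :: links p.2)) => [|r Hr].
  apply: (emits_ext (f := fun w _ => 1 :: enc_seq enc_name (start G w))).
    by move=> w rho _; rewrite /= cats0.
  by apply: emits_cons; apply: emits_start_names.
apply: (emits_ext (f := fun _ rho =>
  (1 :: enc_seq enc_name (map (nmf G (eva rho (sP r))) (lhs r))) ++
  flatten [seq 1 :: enc_seq enc_name (map (nmf G (eva rho (sal r))) B) | B <- links r])).
  by move=> w rho _; rewrite lhs_inst links_inst /= -!map_comp.
apply: emits_cat; first by apply: emits_cons; apply: emits_nmfs.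
apply: (emits_flatten (h := fun B (_ : seq T) rho =>
  1 :: enc_seq enc_name (map (nmf G (eva rho (sal r))) B))).
by apply: allProp_intro => B; apply: emits_cons; apply: emits_nmfs.
Qed.

Lemma emits_Gw_rules : emits degree 0 (fun (w : seq T) _ =>
  enc_seq (@enc_rule T) (rules (Gww w))).
Proof.
apply: (emits_ext (f := fun w _ => enc_seq (@enc_rule T) ([::] ++
  flatten [seq [:: p.2] | p <- insts w]))).
  by move=> w rho _; congr enc_seq; elim: (insts w) => //= p l ->.
apply: emits_section => [|r Hr]; first exact: emits_nil.
apply: emits_ext (emits_cons 1 (emits_rule (sname (sP r)) (sname (sal r)) degree r)) => w rho _.
rewrite /= cats0; congr (_ :: enc_rule _).
by apply: arule_ext => C _; rewrite (nmf_atoms w).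
Qed.

Lemma emits_output : emits degree 0 (fun (w : seq T) _ =>
  enc_rtg (rules G) (Hww w) ++ enc_transducer (Gww w)).
Proof.
apply: emits_cat.
  apply: emits_cat; first exact: emits_Hw_nts.
  apply: emits_cat; last exact: emits_Hw_rules.
  exact: emits_le (leq0n _) (emits_start_hname 0).
apply: emits_cat; first exact: emits_Gw_nts.
apply: emits_cat; first exact: emits_Gw_bigs.
apply: emits_cat; first exact: emits_le (leq0n _) (emits_start_name 0 _).
apply: emits_cat; first exact: emits_le (leq0n _) (emits_start_name 0 _).
exact: emits_Gw_rules.
Qed.

End Output.

(** The binomial expansion of k(n + 1)^D has leading coefficient k, so positivity of k makes the
    degree exactly D. *)
Lemma binomial_poly (k D : nat) : 0 < k -> exists p : {poly nat},
  size p = D.+1 /\ forall n, k * n.+1 ^ D <= horner p n.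
Proof.
move=> hk; exists (\poly_(i < D.+1) (k * 'C(D, i))%N)%R; split.
  by rewrite size_poly_eq //= binn muln1 -lt0n.
move=> n; rewrite horner_poly -addn1 addnC expnDn big_distrr /=.
by apply: leq_sum => i _; rewrite exp1n mul1n mulnA leq_mul.
Qed.

Theorem theorem82 (Sigma : finType) (rk : Sigma -> nat) (V : eqType)
    (G : transducer V Sigma) (wfG : wf rk G) (Delta : {set Sigma}) :
  exists (P : cmd) (p : {poly nat}),
    size p = (mult G * (width G + 1) * (rule_width G + 1)).+1 /\
    forall w : seq Sigma, all (fun a => a \in Delta) w ->
      exists (H : rtg (seq nat) (rule V Sigma))
             (Gw : transducer (seq nat) Sigma) (t : nat),
        [/\ computes P (enc_word w) (enc_rtg (rules G) H ++ enc_transducer Gw) t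
              /\ t <= horner p (size w),
            wf_rtg (rules G) (@rule_rk V Sigma) H,
            wf rk Gw,
            forall d : tree (rule V Sigma),
              rtg_lang H d <->
              Lder G d /\
              exists t1 t2 : tree Sigma,
                der_val d = [:: emb V t1; emb V t2] /\ tau Gw t1 t2
          & forall t1 t2 : tree Sigma,
              tau Gw t1 t2 <-> tau G t1 t2 /\ yd Delta t1 = w].
Proof.
have [inN1 [h1 h2 h3]] := wf_part wfG.
pose D := [pred a | a \in Delta].
pose dflt : seq (pexp * Sigma) * (V -> sann) * (V -> sann) :=
  ([::], fun _ _ => (pvar 0, pvar 0), fun _ _ => (pvar 0, pvar 0)).
have [|F HF] := finite_choice dflt (s := rules G)
    (Q := fun r q => template G inN1 D r q.1.1 q.1.2 q.2).
  by move=> r /(rule_template wfG inN1 D)[cs [sP [sal H]]]; exists (cs, sP, sal).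
pose conds r := (F r).1.1; pose sP r := (F r).1.2; pose sal r := (F r).2.
have Hc : forall r, r \in rules G -> forall w rho, holds w rho (conds r) ->
  valid inN1 D w r (eva rho (sP r)) (eva rho (sal r)) by move=> r /HF[].
have Hv r (hr : r \in rules G) := (HF r hr).2.
have [P [k HP]] := emits_output wfG conds sP sal.
(* The successor of [k] guarantees a nonzero leading coefficient. *)
have [p [Ep Hp]] := @binomial_poly k.+1 (mult G * (width G + 1) * (rule_width G + 1)) isT.
exists P, p; split=> // w _.
have [//|s [t [x _ o b]]] := HP w [::] (State (fun=> 0) [::]) erefl.
have Hs := insts_valid Hc; have Ha := valid_insts wfG Hv.
exists (Hw G w (insts G conds sP sal w)), (Gw G w (insts G conds sP sal w)), t; split.
- split; first by exists s.
  by apply: leq_trans b (leq_trans _ (Hp _)); rewrite leq_mul2r leqnSn orbT.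
- exact: wf_Hw (Hs w).
- exact: (wf_Gw wfG h1 h2 h3 (Hs w)).
- exact: (rtg_lang_HwP wfG h1 h2 h3 (Hs w) (@Ha w)).
- exact: (tau_GwP wfG h1 h2 h3 (Hs w) (@Ha w)).
Qed.
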